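(* Let $n\ge 2$ be an integer and let $\mathbf u$ be a transpositional sequence in $\mathrm{Sym}(n)$ whose transpositional multigraph $\mathcal T(\mathbf u)$ is connected on the vertex set $n=\{0,1,\ldots,n-1\}$. (i) If $n=2$, then $\mathbf u$ is both perm-complete and conjugacy invariant. (ii) If $n=3$, then $\mathbf u$ is conjugacy invariant if and only if either $|\mathbf u|$ is odd or $\mathcal T(\mathbf u)$ is a multitree having at least one simple multiedge. (iii) If $n\ge 4$, then $\mathbf u$ is conjugacy invariant if and only if $\mathcal T(\mathbf u)$ is a multitree in which no vertex is an endpoint of more than one non-simple multiedge, and in which each multiedge of even multiplicity is a multitwig whose non-leaf vertex has exactly two neighbors.
   Context: For a positive integer $n$, $n$ denotes the set $\{0,1,\ldots,n-1\}$; $\mathrm{Sym}(n)$ is the symmetric group on it and $\mathrm{Alt}(n)$ the alternating group. Permutations are composed left to right: $x(f\circ g)=(xf)g$. For a finite sequence $\mathbf s=\langle s_0,\ldots,s_{k-1}\rangle$ in $\mathrm{Sym}(n)$, $|\mathbf s|=k$, $\bigcirc\mathbf s=s_0\circ s_1\circ\cdots\circ s_{k-1}$, $\mathrm{Seq}(\mathbf s)$ is the set of all rearrangements $\langle s_{\psi(0)},\ldots,s_{\psi(k-1)}\rangle$ with $\psi\in\mathrm{Sym}(k)$, and $\mathrm{Prod}(\mathbf s)=\{\bigcirc\mathbf r:\mathbf r\in\mathrm{Seq}(\mathbf s)\}$. $\mathbf s$ is perm-complete iff $\mathrm{Prod}(\mathbf s)$ equals $\mathrm{Alt}(n)$ or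 $\mathrm{Sym}(n)\setminus\mathrm{Alt}(n)$. $\mathbf s$ is conjugacy invariant iff every element of $\mathrm{Prod}(\mathbf s)$ is conjugate in $\mathrm{Sym}(n)$ to $\bigcirc\mathbf s$. A transpositional sequence is a finite sequence whose terms are transpositions $(x\,y)$. Its transpositional multigraph $\mathcal T(\mathbf u)$ is the multigraph on vertex set $n$ in which the multiedge $(x\,y)$ has multiplicity equal to the number of terms of $\mathbf u$ equal to $(x\,y)$. A multiedge is simple if its multiplicity is $1$ and non-simple if its multiplicity is $\ge 2$; two vertices are neighbors if joined by a multiedge of positive multiplicity. A multitree is a multigraph whose underlying simple graph (ignoring multiplicities) is a tree. A multitwig is a multiedge $(v\,w)$ of positive multiplicity one of whose endpoints, say $v$, has exactly one neighbor; $v$ is its leaf and $w$ its non-leaf vertex. *)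

(* Defs.v *)
From HB Require Import structures.
From mathcomp Require Import all_boot all_fingroup.
From mathcomp Require Import alt.

Set Implicit Arguments.
Unset Strict Implicit.
Unset Printing Implicit Defensive.

Import GroupScope.

(* The product of ['S_n] composes left to right ([permM]), so this is
   s_0 o s_1 o ... o s_(k-1) acting on the right. *)
Definition seq_prod n (s : seq 'S_n) : 'S_n := \prod_(f <- s) f.

(* [permutations s] lists all rearrangements of [s]. *)
Definition Prod n (s : seq 'S_n) : {set 'S_n} :=
  [set g in [seq seq_prod r | r <- permutations s]].

Definition perm_complete n (s : seq 'S_n) : Prop :=
  Prod s = 'Alt_('I_n) \/ Prod s = 'Sym_('I_n) :\: 'Alt_('I_n).

Definition conjugacy_invariant n (s : seq 'S_n) : Prop :=
  forall g, g \in Prod s -> g \in seq_prod s ^: 'Sym_('I_n).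

Definition transpositional n (u : seq 'S_n) : Prop :=
  forall t, t \in u -> exists x y : 'I_n, x != y /\ t = tperm x y.

(* [mult G x y] is the multiplicity of the multiedge (x y); multiplicity 0
   means that (x y) is not a multiedge of [G]. *)
Record multigraph (V : finType) := Multigraph {
  mult : V -> V -> nat;
  mult_sym : forall x y, mult x y = mult y x;
  mult_irr : forall x, mult x x = 0%N }.

Section MultigraphNotions.
Variables (V : finType) (G : multigraph V).

(* This is also the edge relation of the underlying simple graph. *)
Definition neighbor : rel V := fun x y => (0 < mult G x y)%N.

Definition neighbors (x : V) : {set V} := [set y | neighbor x y].

Definition simple_edge (x y : V) : bool := mult G x y == 1%N.

Definition nonsimple_edge (x y : V) : bool := (2 <= mult G x y)%N.

Definition mg_connected : Prop := forall x y, connect neighbor x y.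

Definition mg_acyclic : Prop :=
  forall c : seq V, (3 <= size c)%N -> ~ ucycle neighbor c.

(* Connectedness does not exclude an empty vertex set, which a tree must. *)
Definition multitree : Prop := [/\ (0 < #|V|)%N, mg_connected & mg_acyclic].

(* (v w) is a multitwig with leaf v and non-leaf vertex w. *)
Definition multitwig (v w : V) : Prop := neighbor v w /\ #|neighbors v| = 1%N.

End MultigraphNotions.

(* The diagonal is cut off since [tperm x x] is the identity. *)
Definition tmult n (u : seq 'S_n) (x y : 'I_n) : nat :=
  if x == y then 0%N else count_mem (tperm x y) u.

Lemma tmult_sym n (u : seq 'S_n) x y : tmult u x y = tmult u y x.
Proof. by rewrite /tmult eq_sym tpermC. Qed.

Lemma tmult_irr n (u : seq 'S_n) x : tmult u x x = 0%N.
Proof. by rewrite /tmult eqxx. Qed.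

Definition tgraph n (u : seq 'S_n) : multigraph 'I_n :=
  Multigraph (tmult_sym u) (tmult_irr u).

(* Main.v *)
Require Import Defs.
From mathcomp Require Import all_boot all_fingroup.
From mathcomp Require Import alt zify.

(* Up to conjugation a product of transpositions is a cyclic word, and its
   conjugacy class determines the sum of the squared cycle lengths (its energy);
   (x y) g has larger energy than g when x and y lie in different cycles of g.

   Necessity: fix one ordering of most of the sequence and let W be its product.
   The words in the remaining letters, which move at most four points, are
   multiplied by W, and equality of the energies of all these products is
   contradictory. Writing W = s N, where s moves only the four points and N has
   them in different cycles of lengths l_0, ..., l_3, each energy is a quadratic
   form in the l_i, so this is arithmetic for each of the 24 possible s. If the
   graph has a cycle, the four points lie on it, or three on it and one next to
   it; in a tree they surround the offending multiedges, and s = 1.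

   Sufficiency: the letters of even multiplicity can be deleted up to conjugacy,
   as each commutes with all other letters but one. The remaining letters of
   multiplicity at least 3 commute; pushing them to the right conjugates the
   simple letters and leaves one copy of each. This rewrites the product as one
   of m - 1 transpositions connecting the m vertices on odd multiedges, so it is
   an m-cycle on a set of vertices independent of the ordering. *)

Set Implicit Arguments.
Unset Strict Implicit.
Unset Printing Implicit Defensive.

Import GroupScope.

(** * Cycle energy *)

Section Cycles.
Variable T : finType.
Implicit Types (g h : {perm T}) (x y z : T) (A : {set T}).

Lemma iter_closed g A x i :
  (forall z, z \in A -> g z \in A) -> x \in A -> iter i g x \in A.
Proof. by move=> gA xA; elim: i => //= i /gA. Qed.

Lemma porbit_sub g A x :
  (forall z, z \in A -> g z \in A) -> x \in A -> porbit g x \subset A.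
Proof.
by move=> gA xA; apply/subsetP=> _ /porbitP[i ->]; rewrite permX iter_closed.
Qed.

Lemma porbit_step g x y : (g y \in porbit g x) = (y \in porbit g x).
Proof.
by rewrite -!eq_porbit_mem -[g y]/((g ^+ 1) y) porbit_perm.
Qed.

Lemma porbit_eq g x y : y \in porbit g x -> porbit g y = porbit g x.
Proof. by rewrite -eq_porbit_mem => /eqP. Qed.

Lemma porbit_fix g x : g x = x -> porbit g x = [set x].
Proof.
move=> gx; apply/eqP; rewrite eqEsubset sub1set porbit_id andbT.
by apply: porbit_sub; rewrite ?set11 // => z /set1P->; rewrite gx set11.
Qed.

(** The product sends [y] to [g x] and agrees with [g] at every point of the cycle of [x] other than
    [x], since [y] is not on it. Starting from [y] it therefore runs through that whole cycle. *)
Lemma porbit_merge_sub g x y : y \notin porbit g x ->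
  porbit g x \subset porbit (tperm x y * g) y.
Proof.
move=> yx.
have gx_ty : g x \in porbit (tperm x y * g) y.
  have -> : g x = (tperm x y * g) y by rewrite permM tpermR.
  by rewrite porbit_step porbit_id.
have step i : (g ^+ i.+1) x \in porbit (tperm x y * g) y.
  elim: i => [|i IH]; first by rewrite expg1.
  rewrite expgSr permM; have [->//|nx] := eqVneq ((g ^+ i.+1) x) x.
  have -> : g ((g ^+ i.+1) x) = (tperm x y * g) ((g ^+ i.+1) x).
    rewrite permM tpermD // eq_sym //.
    by apply: contraNneq yx => <-; rewrite mem_porbit.
  by rewrite porbit_step.
apply/subsetP=> _ /porbitP[[|i] ->]; last exact: step.
have := step #|porbit g x|.-1.
rewrite prednK ?lt0n ?card_porbit_neq0 // permX iter_porbit.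
by rewrite expg0 perm1.
Qed.

(** The inclusion above, used both ways, puts both old cycles into one new cycle; their union is
    closed, and off the union the two permutations agree. *)
Lemma porbit_merge g x y z : y \notin porbit g x ->
  porbit (tperm x y * g) z =
  if z \in porbit g x :|: porbit g y then porbit g x :|: porbit g y
  else porbit g z.
Proof.
move=> yx; set U := _ :|: _.
have xy : x \notin porbit g y by rewrite porbit_sym.
have sx := porbit_merge_sub yx.
have sy := porbit_merge_sub xy; rewrite tpermC in sy.
have exy : porbit (tperm x y * g) x = porbit (tperm x y * g) y.
  by apply: porbit_eq; apply: (subsetP sx); apply: porbit_id.
have clU w : w \in U -> (tperm x y * g) w \in U.
  rewrite permM !inE !porbit_step.
  case: tpermP => [->|->|//] _; first by rewrite porbit_id orbT.
  by rewrite porbit_id.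
have eU : porbit (tperm x y * g) x = U.
  apply/eqP; rewrite eqEsubset porbit_sub //; last by rewrite inE porbit_id.
  by rewrite subUset sy exy sx.
case: ifPn => [zU|zU]; first by rewrite -eU; apply: porbit_eq; rewrite eU.
have nz w : w \in porbit g z -> w \notin [set x; y].
  move=> wz; apply: contra zU; rewrite !inE porbit_sym in wz * => /orP[]/eqP ew.
    by rewrite -ew wz.
  by rewrite -ew wz orbT.
have iterE i : ((tperm x y * g) ^+ i) z = (g ^+ i) z.
  elim: i => // i IH; rewrite !expgSr !permM IH tpermD //.
    by have := nz _ (mem_porbit g i z); rewrite !inE eq_sym; case/norP.
  by have := nz _ (mem_porbit g i z); rewrite !inE orbC eq_sym; case/norP.
by apply/setP=> w; apply/porbitP/porbitP=> -[i ->]; exists i; rewrite iterE.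
Qed.

Lemma porbit_merge_disjoint g x y : y \notin porbit g x ->
  [disjoint porbit g x & porbit g y].
Proof.
move=> yx; rewrite disjoint_subset; apply/subsetP=> z zx; rewrite inE /=.
apply: contra yx => zy; rewrite -(porbit_eq zx) (porbit_eq zy).
exact: porbit_id.
Qed.

(* The sum of the squares of the cycle lengths. *)
Definition cycle_energy g := (\sum_x #|porbit g x|)%N.

Lemma cycle_energyJ g h : cycle_energy (g ^ h) = cycle_energy g.
Proof.
rewrite /cycle_energy (reindex_inj (@perm_inj _ h)) /=; apply: eq_bigr => x _.
suff -> : porbit (g ^ h) (h x) = h @: porbit g x.
  by rewrite card_imset //; apply: perm_inj.
have E i : ((g ^ h) ^+ i) (h x) = h ((g ^+ i) x).
  by rewrite -conjXg conjgE !permM permK.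
apply/setP=> y; apply/porbitP/imsetP => [[i ->]|[_ /porbitP[i ->] ->]].
  by exists ((g ^+ i) x); rewrite ?mem_porbit ?E.
by exists i; rewrite E.
Qed.

Lemma cycle_energyC g h : cycle_energy (g * h) = cycle_energy (h * g).
Proof. by rewrite -(cycle_energyJ (g * h) g) conjgE !mulgA mulVg mul1g. Qed.

(** The joined cycles contribute (a + b)^2 in place of a^2 + b^2, and all others are unchanged. *)
Lemma cycle_energy_merge g x y : y \notin porbit g x ->
  cycle_energy (tperm x y * g) =
  (cycle_energy g + 2 * (#|porbit g x| * #|porbit g y|))%N.
Proof.
move=> yx; pose U := porbit g x :|: porbit g y.
have dis := porbit_merge_disjoint yx.
have cU : #|U| = (#|porbit g x| + #|porbit g y|)%N.
  by rewrite cardsU (disjoint_setI0 dis) cards0 subn0.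
rewrite /cycle_energy (bigID (mem U)) [in RHS](bigID (mem U)) /=.
rewrite (eq_bigr (fun=> #|U|)); last by move=> z zU; rewrite porbit_merge // -/U zU.
rewrite [X in (_ + X)%N = _](eq_bigr (fun z => #|porbit g z|)); last first.
  by move=> z zU; rewrite porbit_merge // -/U (negPf zU).
rewrite sum_nat_const addnAC; congr (_ + _)%N.
rewrite (eq_bigl (fun z => z \in [predU porbit g x & porbit g y])); last first.
  by move=> z; rewrite !inE.
rewrite bigU //=.
rewrite (eq_bigr (fun=> #|porbit g x|)); last by move=> z zx; rewrite (porbit_eq zx).
rewrite [X in (_ + X + _)%N](eq_bigr (fun=> #|porbit g y|)); last first.
  by move=> z zx; rewrite (porbit_eq zx).
rewrite !sum_nat_const cU; set a := #|porbit g x|; set b := #|_|.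
rewrite !mulnDl !mulnDr mul2n -addnn (mulnC b a) !addnA.
by rewrite [LHS]addnAC; congr (_ + _)%N; rewrite addnAC.
Qed.

Lemma cycle_energy_merge_gt g x y : y \notin porbit g x ->
  cycle_energy g < cycle_energy (tperm x y * g).
Proof.
move=> yx; rewrite (cycle_energy_merge yx) -addn1 leq_add2l !muln_gt0 /=.
by rewrite !lt0n !card_porbit_neq0.
Qed.

(** Converse of merging. The gain in the number of cycles makes the extraction of letters in
    [separating_factor] terminate. *)
Lemma porbit_split g x y : x != y -> y \in porbit g x ->
  y \notin porbit (tperm x y * g) x /\
  #|porbits (tperm x y * g)| = #|porbits g|.+1.
Proof.
move=> nxy yx; have /= := porbits_mul_tperm g x y.
rewrite porbit_sym yx nxy addn0 addn1 => E; split=> //.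
(* A second multiplication gives back [g]; if [x] and [y] still shared a cycle, the count would rise
   twice. *)
have /= := porbits_mul_tperm (tperm x y * g) x y.
rewrite mulgA tperm2 mul1g E nxy porbit_sym; case: (y \in _) => //=.
by rewrite addn0 addn1 => /eqP; rewrite -[X in X == _]addn0 -addn2 eqn_add2l.
Qed.

End Cycles.

(** * Words in four marked points *)

(* A word in the letters (i, j), i, j < 4, stands for a product of
   transpositions of four marked points. *)
Definition word := seq (nat * nat).

Definition act (w : word) (i : nat) : nat :=
  foldl (fun i p => if i == p.1 then p.2 else if i == p.2 then p.1 else i) i w.

(** Four iterates exhaust a cycle, as there are only four points. *)
Definition word_class (w : word) (i : nat) : seq nat :=
  [seq j <- iota 0 4 | has (fun k => iter k (act w) i == j) (iota 0 4)].

(** If the marked points lie in different cycles of N, of lengths l_i, the sum of l_i l_j over these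
    ordered pairs is the energy that the word adds to N. *)
Definition word_pairs (w : word) : word :=
  [seq p <- [seq (i, j) | i <- iota 0 4, j <- iota 0 4] |
     (p.1 != p.2) && (p.2 \in word_class w p.1)].

Definition valid_word (w : word) := all (fun p => (p.1 < 4) && (p.2 < 4)) w.

Definition same_act (w w' : word) := all (fun i => act w i == act w' i) (iota 0 4).

(* Read from the right, every letter of a merging word joins two cycles. *)
Fixpoint merging (w : word) : bool :=
  if w is p :: w' then
    [&& merging w', p.1 < 4, p.2 < 4, p.2 \notin word_class w' p.1,
     all (fun i =>
            if (i \in word_class w' p.1) || (i \in word_class w' p.2)
            then perm_eq (word_class w i)
                   (word_class w' p.1 ++ word_class w' p.2)
            else word_class w i == word_class w' i) (iota 0 4)
   & perm_eq (word_pairs w) (word_pairs w' ++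
        [seq (i, j) | i <- word_class w' p.1, j <- word_class w' p.2] ++
        [seq (i, j) | i <- word_class w' p.2, j <- word_class w' p.1])]
  else true.

(** One shortest factorization for each of the 24 permutations of four points: 1, 6, 11 and 6 words
    with 0, 1, 2 and 3 letters. *)
Definition merging_words : seq word := [::
  [::]; [:: (0, 1)];
  [:: (0, 2)]; [:: (0, 3)];
  [:: (1, 2)]; [:: (1, 3)];
  [:: (2, 3)]; [:: (0, 1); (0, 2)];
  [:: (0, 1); (0, 3)]; [:: (0, 1); (1, 2)];
  [:: (0, 1); (1, 3)]; [:: (0, 1); (2, 3)];
  [:: (0, 2); (0, 3)]; [:: (0, 2); (1, 3)];
  [:: (0, 2); (2, 3)]; [:: (0, 3); (1, 2)];
  [:: (1, 2); (1, 3)]; [:: (1, 2); (2, 3)];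
  [:: (0, 1); (0, 2); (0, 3)]; [:: (0, 1); (0, 2); (1, 3)];
  [:: (0, 1); (0, 2); (2, 3)]; [:: (0, 1); (0, 3); (1, 2)];
  [:: (0, 1); (1, 2); (1, 3)]; [:: (0, 1); (1, 2); (2, 3)]
]%N.

Lemma merging_wordsP : all merging merging_words.
Proof. by vm_compute. Qed.

(** The induction step for [merging_word_exists]: prefixing any letter, trivial ones included, leads
    back into the list up to the action. *)
Lemma merging_words_closed :
  all (fun p => all (fun w => has (same_act (p :: w)) merging_words)
                    merging_words)
      [seq (i, j) | i <- iota 0 4, j <- iota 0 4].
Proof. by vm_compute. Qed.

Lemma merging_valid w : merging w -> valid_word w.
Proof. by elim: w => //= p w IH /and5P[/IH-> -> ->]. Qed.

Lemma act_lt w i : valid_word w -> i < 4 -> act w i < 4.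
Proof.
elim: w i => //= p w IH i /andP[/andP[p1 p2] vw] i4.
by apply: IH => //; case: eqP => // _; case: eqP.
Qed.

Lemma merging_word_exists w : valid_word w ->
  exists2 w', w' \in merging_words & same_act w w'.
Proof.
elim: w => [|p w IH] /=; first by exists [::].
case/andP=> /andP[p1 p2] /IH[w1 w1M /allP sw].
have pL : p \in [seq (i, j) | i <- iota 0 4, j <- iota 0 4].
  by case: p p1 p2 => i j i4 j4; apply/allpairsP; exists (i, j); rewrite !mem_iota.
have /hasP[w' w'M /allP sw'] := allP (allP merging_words_closed _ pL) _ w1M.
exists w' => //; apply/allP => i i4; rewrite -(eqP (sw' i i4)) /=.
apply: sw; rewrite mem_iota add0n leq0n /=; rewrite mem_iota add0n leq0n /= in i4.
by case: eqP => // _; case: eqP.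
Qed.

Section FourPoints.
Variables (T : finType) (a b c d : T).
Hypothesis pts_uniq : uniq [:: a; b; c; d].
Implicit Types (w : word) (N : {perm T}).

Definition pt (i : nat) : T := nth a [:: a; b; c; d] i.

Definition word_perm w : {perm T} := \prod_(p <- w) tperm (pt p.1) (pt p.2).

Definition separates N := forall i j, i < 4 -> j < 4 -> i != j ->
  pt j \notin porbit N (pt i).

Lemma pt_inj i j : i < 4 -> j < 4 -> (pt i == pt j) = (i == j).
Proof. by move=> i4 j4; rewrite /pt nth_uniq. Qed.

Lemma word_perm_pt w i : valid_word w -> i < 4 ->
  word_perm w (pt i) = pt (act w i).
Proof.
rewrite /word_perm; elim: w i => [|p w IH] i /=; first by rewrite big_nil perm1.
case/andP=> /andP[p1 p2] vw i4; rewrite big_cons permM -IH //; last first.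
  by case: eqP => // _; case: eqP.
congr (_ _); have [->|n1] := eqVneq i p.1; first by rewrite tpermL.
have [->|n2] := eqVneq i p.2; first by rewrite tpermR.
by rewrite tpermD // pt_inj // eq_sym.
Qed.

Lemma word_perm_out w z : valid_word w -> (forall i, i < 4 -> z != pt i) ->
  word_perm w z = z.
Proof.
move=> + zo; rewrite /word_perm; elim: w => [|p w IH] /=.
  by rewrite big_nil perm1.
case/andP=> /andP[p1 p2] /IH {2}<-; rewrite big_cons permM tpermD //.
  by rewrite eq_sym zo.
by rewrite eq_sym zo.
Qed.

Lemma eq_word_perm w w' : valid_word w -> valid_word w' -> same_act w w' ->
  word_perm w = word_perm w'.
Proof.
move=> vw vw' /allP sw; apply/permP=> z.
have [/hasP[i]|zo] := boolP (has (fun i => z == pt i) (iota 0 4)).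
  rewrite mem_iota => /= i4 /eqP->; rewrite !word_perm_pt //.
  by rewrite (eqP (sw _ _)) // mem_iota.
have {}zo i : i < 4 -> z != pt i.
  by move=> i4; apply: contra zo => zi; apply/hasP; exists i; rewrite ?mem_iota.
by rewrite !word_perm_out.
Qed.

Section Energy.
Variable N : {perm T}.
Hypothesis sepN : separates N.

Definition point_length i := #|porbit N (pt i)|.

Definition class_length s := sumn (map point_length s).

Definition pairs_energy (s : word) :=
  sumn [seq (point_length p.1 * point_length p.2)%N | p <- s].

Lemma pairs_energy_prod s s' :
  pairs_energy [seq (i, j) | i <- s, j <- s'] =
  (class_length s * class_length s')%N.
Proof.
rewrite /pairs_energy /class_length; elim: s => [|i s IH] /=.
  by rewrite mul0n.
rewrite map_cat sumn_cat IH mulnDl; congr (_ + _)%N.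
by elim: s' {IH} => [|j s' IH] /=; rewrite ?muln0 // IH mulnDr.
Qed.

Lemma class_length_perm s s' : perm_eq s s' -> class_length s = class_length s'.
Proof. by move=> p; apply/perm_sumn/perm_map. Qed.

(** Induction over the letters from the right. The claims are proved together: the classes show that
    the next letter joins two cycles of the product, and the lengths of these give the gain in
    energy. *)
Lemma merging_spec w : merging w ->
  [/\ forall i j, i < 4 -> j < 4 ->
        (pt j \in porbit (word_perm w * N) (pt i)) = (j \in word_class w i),
      forall i, i < 4 ->
        #|porbit (word_perm w * N) (pt i)| = class_length (word_class w i)
    & cycle_energy (word_perm w * N) =
      (cycle_energy N + pairs_energy (word_pairs w))%N].
Proof.
elim: w => [_|p w IH].
  rewrite /word_perm big_nil mul1g; split.
  - move=> i j i4 j4; have [<-|nij] := eqVneq i j.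
      by rewrite porbit_id; case: i i4 => [|[|[|[|]]]].
    rewrite (negPf (sepN i4 j4 nij)).
    by case: i i4 nij => [|[|[|[|]]]]; case: j j4 => [|[|[|[|]]]].
  - by move=> [|[|[|[|]]]] //= _; rewrite /class_length /= addn0.
  - by rewrite addn0.
case/and5P=> mw p1 p2 np /andP[/allP cl pe]; have {IH}[I1 I2 I3] := IH mw.
have yx : pt p.2 \notin porbit (word_perm w * N) (pt p.1) by rewrite I1.
have E : word_perm (p :: w) * N = tperm (pt p.1) (pt p.2) * (word_perm w * N).
  by rewrite /word_perm big_cons mulgA.
have cU : #|porbit (word_perm w * N) (pt p.1) :|:
            porbit (word_perm w * N) (pt p.2)| =
          class_length (word_class w p.1 ++ word_class w p.2).
  rewrite cardsU (disjoint_setI0 (porbit_merge_disjoint yx)) cards0 subn0 !I2 //.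
  by rewrite /class_length map_cat sumn_cat.
rewrite {}E; split.
- move=> i j i4 j4; rewrite porbit_merge // in_setU !I1 //.
  have := cl i; rewrite mem_iota => /(_ i4).
  case: ifP => _; last by move=> /eqP->; rewrite I1.
  by move=> /perm_mem->; rewrite in_setU !I1 // mem_cat.
- move=> i i4; rewrite porbit_merge // in_setU !I1 //.
  have := cl i; rewrite mem_iota => /(_ i4).
  case: ifP => _; last by move=> /eqP->; rewrite I2.
  by move=> /class_length_perm->.
- have Ep : pairs_energy (word_pairs (p :: w)) =
      (pairs_energy (word_pairs w) +
       2 * (class_length (word_class w p.1) * class_length (word_class w p.2)))%N.
    rewrite {1}/pairs_energy (perm_sumn (perm_map _ pe)) 2!map_cat 2!sumn_cat.
    congr addn; rewrite -![sumn (map _ _)]/(pairs_energy _).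
    by rewrite 2!pairs_energy_prod mul2n -addnn; congr addn; rewrite mulnC.
  by rewrite Ep addnA cycle_energy_merge // I3 I2 // I2.
Qed.

(** The formula extends from merging words to all words because both sides depend only on the action
    of the word. *)
Lemma word_energy w : valid_word w ->
  cycle_energy (word_perm w * N) =
  (cycle_energy N + pairs_energy (word_pairs w))%N.
Proof.
move=> vw; have [w' w'M sw] := merging_word_exists vw.
have mw' := allP merging_wordsP _ w'M; have vw' := merging_valid mw'.
rewrite (eq_word_perm vw vw' sw).
suff -> : word_pairs w = word_pairs w' by have [] := merging_spec mw'.
apply: eq_in_filter => -[i j] /allpairsP[[i1 j1] [i4 j4 [-> ->]]] /=.
congr (_ && _); congr (_ \in _); apply: eq_filter => k; apply: eq_has => m.
rewrite mem_iota in i4; congr (_ == _).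
suff [-> //] : iter m (act w) i1 = iter m (act w') i1 /\ iter m (act w') i1 < 4.
elim: m => //= m [-> m4]; split; last exact: act_lt.
by apply/eqP; apply: (allP sw); rewrite mem_iota.
Qed.

End Energy.

(** As long as two marked points share a cycle, their transposition splits it. The number of cycles
    grows and is at most [#|T|], so this stops; the letters used form [w]. *)
Lemma separating_factor W : exists w N,
  [/\ valid_word w, separates N & W = word_perm w * N].
Proof.
have [m] := ubnP (#|T| - #|porbits W|); elim: m => // m IH in W * => lm.
pose bad p := (p.1 != p.2) && (pt p.2 \in porbit W (pt p.1)).
have [/hasP[[i j]]|nb] := boolP (has bad [seq (i, j) | i <- iota 0 4, j <- iota 0 4]).
  case/allpairsP=> -[i1 j1] [i4 j4 [-> ->]] /andP[/= nij ij].
  rewrite !mem_iota /= in i4 j4.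
  have nij' : pt i1 != pt j1 by rewrite pt_inj.
  have [_ E] := porbit_split nij' ij.
  have le : #|porbits (tperm (pt i1) (pt j1) * W)| <= #|T|.
    exact: leq_imset_card.
  have [|w [N [vw sN EW]]] := IH (tperm (pt i1) (pt j1) * W).
    by move: lm le; rewrite E; lia.
  exists ((i1, j1) :: w), N; split=> //=; first by rewrite i4 j4.
  by rewrite /word_perm big_cons -mulgA -[X in _ * (X * _)]/(word_perm w) -EW
    mulgA tperm2 mul1g.
exists [::], W; split=> //; last by rewrite /word_perm big_nil mul1g.
move=> i j i4 j4 nij; apply: contra nb => ij; apply/hasP; exists (i, j).
  by apply/allpairsP; exists (i, j); rewrite !mem_iota.
by rewrite /bad nij.
Qed.

End FourPoints.

(* Found by computer search: for each of the 24 permutations s of the points,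
   the products v s, v in witness_words, do not all have the same energy. *)
Definition witness_words : seq word :=
  [:: [:: (0, 1); (2, 3)]; [:: (0, 2); (1, 3)]; [:: (0, 3); (1, 2)];
      [:: (0, 2); (2, 3)]; [:: (0, 1); (1, 3)]]%N.

(** The cycle lengths are abstracted to arbitrary positive [l i], so once [w] is one of the 24 words
    only arithmetic on quadratic forms is left. *)
Lemma witness_words_energy (l : nat -> nat) w :
    (forall i, 0 < l i) -> w \in merging_words ->
    (forall v, v \in witness_words ->
      sumn [seq (l p.1 * l p.2)%N | p <- word_pairs (v ++ w)] =
      sumn [seq (l p.1 * l p.2)%N | p <- word_pairs (nth [::] witness_words 0 ++ w)]) ->
  False.
Proof.
move=> lpos wM H.
have := H (nth [::] witness_words 4) isT; have := H (nth [::] witness_words 3) isT.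
have := H (nth [::] witness_words 2) isT; have := H (nth [::] witness_words 1) isT.
have := lpos 0; have := lpos 1%N; have := lpos 2; have := lpos 3; clear H.
move: wM; rewrite !inE.
do 23?[case/orP; last first]; move=> /eqP->;
repeat match goal with |- context [word_pairs ?w] =>
  let v := eval vm_compute in (word_pairs w) in change (word_pairs w) with v end;
rewrite /=; move: (l 0) (l 1%N) (l 2) (l 3) => a b c d {lpos}; move=> *.
(* Positivity of the six monomials lets linear arithmetic treat them as atoms where that is
   enough. *)
all: have ab : 0 < a * b by rewrite muln_gt0; apply/andP.
all: have ac : 0 < a * c by rewrite muln_gt0; apply/andP.
all: have ad : 0 < a * d by rewrite muln_gt0; apply/andP.
all: have bc : 0 < b * c by rewrite muln_gt0; apply/andP.
all: have bd : 0 < b * d by rewrite muln_gt0; apply/andP.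
all: have cd : 0 < c * d by rewrite muln_gt0; apply/andP.
all: by [lia | nia].
Qed.

Lemma card_porbit_gt0 (T : finType) (g : {perm T}) x : 0 < #|porbit g x|.
Proof. by rewrite lt0n card_porbit_neq0. Qed.

Section FourPoints.
Variables (T : finType) (a b c d : T).
Hypothesis pts_uniq : uniq [:: a; b; c; d].
Implicit Types (w : word) (N V W : {perm T}).

Local Notation wperm := (word_perm a b c d).

(** Any [W] is a permutation of the four points times a separating [N]. The first factor may be
    taken from the list, and the previous lemma applies to the cycle lengths of [N]. *)
Lemma witness_words_contra W q :
  (forall v, v \in witness_words -> cycle_energy (wperm v * W) = q) -> False.
Proof.
have [w [N [vw sN ->]]] := separating_factor pts_uniq W.
have [w' w'M sw] := merging_word_exists vw; have mw' := allP merging_wordsP _ w'M.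
rewrite (eq_word_perm pts_uniq vw (merging_valid mw') sw) => H.
have lpos i : 0 < point_length a b c d N i by apply: card_porbit_gt0.
refine (witness_words_energy lpos w'M _) => v vW.
have E u : u \in witness_words ->
    cycle_energy (wperm (u ++ w') * N) = q.
  by move=> uW; rewrite -(H u uW) /word_perm big_cat /= mulgA.
have vv u : u \in witness_words -> valid_word (u ++ w').
  rewrite /valid_word all_cat => uW; apply/andP; split; last exact: merging_valid.
  by move: uW; rewrite !inE => /or4P[| | |/orP[]] /eqP->.
have P u : u \in witness_words -> (cycle_energy N +
    pairs_energy a b c d N (word_pairs (u ++ w')))%N = q.
  by move=> uW; rewrite -(E u uW) (word_energy pts_uniq sN (vv u uW)).
apply: (@addnI (cycle_energy N)); apply: etrans (P v vW) (esym _).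
exact: (P (nth [::] witness_words 0) isT).
Qed.

(** Turns equal energies of rearrangements into equations in abstract positive lengths, ready for
    arithmetic. *)
Lemma separated_words_contra (l : word) (ws : seq word) V q :
    separates a b c d V -> valid_word l ->
    (forall w, perm_eq w l -> cycle_energy (wperm w * V) = q) ->
    all (perm_eq l) ws ->
    exists2 lam : nat -> nat, forall i, 0 < lam i
      & forall w, w \in ws ->
        (cycle_energy V + sumn [seq (lam p.1 * lam p.2)%N | p <- word_pairs w])%N = q.
Proof.
move=> sV vl H /allP wsl; exists (point_length a b c d V).
  by move=> i; apply: card_porbit_gt0.
move=> w /wsl; rewrite perm_sym => wl.
have vw : valid_word w by rewrite /valid_word (perm_all _ wl).
by rewrite -(H w wl) (word_energy pts_uniq sV vw).
Qed.

(** Compares four rearrangements, the entries 0 to 3 of [ws]. *)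
Ltac words_arith H sV ws :=
  let lam := fresh "lam" in let lpos := fresh "lpos" in let E := fresh "E" in
  have [//|//|lam lpos E] := separated_words_contra (ws := ws) sV _ H;
  have := E (nth [::] ws 0) isT; have := E (nth [::] ws 1%N) isT;
  have := E (nth [::] ws 2) isT; have := E (nth [::] ws 3) isT; clear E;
  repeat match goal with |- context [word_pairs ?w] =>
    let v := eval vm_compute in (word_pairs w) in change (word_pairs w) with v end;
  rewrite /=;
  have := lpos 0; have := lpos 1%N; have := lpos 2; have := lpos 3;
  move: (lam 0) (lam 1%N) (lam 2) (lam 3) => ? ? ? ? *; nia.

(** Multiplicities 2, 1, 1 at the centre 0. With cycle lengths l_i, equal energies of the first and
    last word give l_0 = l_1, those of the first two give l_0 + l_3 = l_1. *)
Lemma star_words_contra V q : separates a b c d V ->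
  (forall w, perm_eq w [:: (0, 1); (0, 1); (0, 2); (0, 3)]%N ->
     cycle_energy (wperm w * V) = q) -> False.
Proof.
move=> sV H.
words_arith H sV [:: [:: (0, 1); (0, 1); (0, 2); (0, 3)];
   [:: (0, 1); (0, 2); (0, 1); (0, 3)]; [:: (0, 1); (0, 3); (0, 1); (0, 2)];
   [:: (0, 1); (0, 2); (0, 3); (0, 1)]]%N.
Qed.

(** Multiplicities 1, 2, 1 along a path. The first two words give l_1 = l_2 + l_3, the first and
    third l_2 = l_0 + l_1. *)
Lemma middle_words_contra V q : separates a b c d V ->
  (forall w, perm_eq w [:: (1, 2); (1, 2); (0, 1); (2, 3)]%N ->
     cycle_energy (wperm w * V) = q) -> False.
Proof.
move=> sV H.
words_arith H sV [:: [:: (1, 2); (1, 2); (0, 1); (2, 3)];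
   [:: (1, 2); (0, 1); (1, 2); (2, 3)]; [:: (1, 2); (2, 3); (1, 2); (0, 1)];
   [:: (1, 2); (0, 1); (2, 3); (1, 2)]]%N.
Qed.

(** The first two words give l_0 = l_1, the first and last l_0 = l_1 + l_2. *)
Lemma path231_words_contra V q : separates a b c d V ->
  (forall w, perm_eq w [:: (0, 1); (0, 1); (1, 2); (1, 2); (1, 2); (2, 3)]%N ->
     cycle_energy (wperm w * V) = q) -> False.
Proof.
move=> sV H.
words_arith H sV [:: [:: (0, 1); (0, 1); (1, 2); (1, 2); (1, 2); (2, 3)];
   [:: (0, 1); (1, 2); (1, 2); (1, 2); (0, 1); (2, 3)];
   [:: (1, 2); (0, 1); (1, 2); (0, 1); (1, 2); (2, 3)];
   [:: (0, 1); (1, 2); (2, 3); (1, 2); (0, 1); (1, 2)]]%N.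
Qed.

(** The first word reduces to one transposition, the third to a 4-cycle, which gives more energy.
    The first is listed twice because four words are read. *)
Lemma path232_words_contra V q : separates a b c d V ->
  (forall w, perm_eq w
     [:: (0, 1); (0, 1); (1, 2); (1, 2); (1, 2); (2, 3); (2, 3)]%N ->
     cycle_energy (wperm w * V) = q) -> False.
Proof.
move=> sV H.
words_arith H sV
  [:: [:: (0, 1); (0, 1); (1, 2); (1, 2); (1, 2); (2, 3); (2, 3)];
   [:: (0, 1); (0, 1); (1, 2); (1, 2); (1, 2); (2, 3); (2, 3)];
   [:: (1, 2); (0, 1); (1, 2); (0, 1); (2, 3); (1, 2); (2, 3)];
   [:: (1, 2); (0, 1); (1, 2); (0, 1); (1, 2); (2, 3); (2, 3)]]%N.
Qed.

End FourPoints.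

(** * Sequences of transpositions *)

Section Transpositions.
Variable T : finType.
Implicit Types (u v r : seq {perm T}) (x y z : T) (e f t : {perm T}).

Definition transpositions u :=
  forall t, t \in u -> exists x y, x != y /\ t = tperm x y.

Definition joined u : rel T := fun x y => (x != y) && (tperm x y \in u).

Definition forest u := forall c, 3 <= size c -> ~ ucycle (joined u) c.

(** What energies see of conjugacy invariance; the necessity arguments take nothing more from it. *)
Definition uniform_energy u := exists q, forall r, perm_eq r u ->
  cycle_energy (\prod_(f <- r) f) = q.

Lemma transpositions_sub u v : {subset v <= u} -> transpositions u -> transpositions v.
Proof. by move=> vu tu t /vu/tu. Qed.

Lemma joined_sym u : symmetric (joined u).
Proof. by move=> x y; rewrite /joined eq_sym tpermC. Qed.

Lemma joined_sub u v : {subset v <= u} -> subrel (joined v) (joined u).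
Proof. by move=> vu x y /andP[nxy /vu xyu]; rewrite /joined nxy. Qed.

Lemma connect_joined_sym u : connect_sym (joined u).
Proof. exact/sym_connect_sym/joined_sym. Qed.

Lemma connect_prod u x : transpositions u ->
  connect (joined u) x ((\prod_(f <- u) f) x).
Proof.
elim: u x => [|t u IH] x tu; first by rewrite big_nil perm1 connect0.
rewrite big_cons permM; have tu' : transpositions u.
  by apply: transpositions_sub tu => f fu; rewrite inE fu orbT.
have sub : subrel (connect (joined u)) (connect (joined (t :: u))).
  apply: connect_sub => y z /andP[nyz yzu]; apply: connect1.
  by rewrite /joined nyz inE yzu orbT.
have {}IH := sub _ _ (IH (t x) tu').
have [a [b [nab Et]]] := tu t (mem_head _ _).
apply: connect_trans IH; rewrite {2}Et.
case: tpermP => [->|->|_ _]; last exact: connect0.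
  by apply: connect1; rewrite /joined nab -Et mem_head.
by apply: connect1; rewrite /joined eq_sym nab tpermC -Et mem_head.
Qed.

Lemma connect_porbit_prod u x y : transpositions u ->
  y \in porbit (\prod_(f <- u) f) x -> connect (joined u) x y.
Proof.
move=> tu /porbitP[i ->]; elim: i => [|i IH]; first by rewrite perm1.
by rewrite expgSr permM; apply: connect_trans IH _; apply: connect_prod.
Qed.

(** A path in [v] from [x] to [y] has at least two edges, as the edge between them is missing from
    [v]; with that edge it closes to a cycle in [u]. *)
Lemma forest_bridge u v x y : forest u -> joined u x y -> {subset v <= u} ->
  tperm x y \notin v -> ~~ connect (joined v) x y.
Proof.
move=> Fu xy vu nv; apply/negP=> /connectP[p0 p0v yl].
case/shortenP: p0v yl => p pv up _ yl {p0}.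
have nxy : x != y by case/andP: xy.
apply: (Fu (x :: p)).
  case: p pv yl {up} => [|a [|b p]] //= pv yl; first by rewrite -yl eqxx in nxy.
  by case/andP: pv => /andP[_]; rewrite -yl (negPf nv).
rewrite /ucycle up andbT /= rcons_path -yl joined_sym xy andbT.
exact: sub_path (joined_sub vu) _ _ pv.
Qed.

Lemma uniform_energy_perm u v : perm_eq u v -> uniform_energy u -> uniform_energy v.
Proof.
by move=> uv [q H]; exists q => r rv; apply: H; rewrite (perm_trans rv) // perm_sym.
Qed.

Lemma uniform_energy_cancel x y u :
  uniform_energy (tperm x y :: tperm x y :: u) -> uniform_energy u.
Proof.
case=> q H; exists q => r ru.
rewrite -(H (tperm x y :: tperm x y :: r)) ?perm_cons //.
by rewrite !big_cons mulgA tperm2 mul1g.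
Qed.

(** Adjacent equal letters cancel, so multiplicities may be lowered by even amounts. Contradictions
    are then needed only for the least multiplicities of each parity. *)
Lemma uniform_energy_nseq x y i j u : j <= i -> odd i = odd j ->
  uniform_energy (nseq i (tperm x y) ++ u) ->
  uniform_energy (nseq j (tperm x y) ++ u).
Proof.
move=> ji; have [k ->] : exists k, i = (k + j)%N.
  by exists (i - j)%N; rewrite subnK.
rewrite oddD; have [m] := ubnP k; elim: m => // m IH in k *.
case: k => [|[|k]] /= km; [by []| by case: (odd j) |rewrite negbK => E].
by move/uniform_energy_cancel/IH; apply; rewrite // ltnW.
Qed.

Lemma extract_letters (E : seq {perm T}) u : uniq E ->
  perm_eq u (flatten [seq nseq (count_mem e u) e | e <- E] ++
             [seq f <- u | f \notin E]).
Proof.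
elim: E u => [|e E IH] u /= ; first by rewrite filter_predT.
case/andP=> eE uE; pose u' := filter (predC1 e) u.
have Ee : filter (pred1 e) u = nseq (count_mem e u) e.
  rewrite -size_filter; apply/all_pred1P; exact: filter_all.
rewrite -(perm_filterC (pred1 e) u) Ee -catA perm_cat2l.
rewrite -/(predC1 e) -[filter _ u]/u' (perm_trans (IH u' uE)) //.
rewrite (_ : [seq nseq (count_mem f u') f | f <- E] =
             [seq nseq (count_mem f u) f | f <- E]); last first.
  apply/eq_in_map => f fE; rewrite count_filter; congr nseq.
  apply: eq_count => h /=; have [->|//] := eqVneq h f.
  by rewrite /=; apply: contraNneq eE => <-.
rewrite perm_cat2l -filter_predI (_ : filter _ _ = [seq f <- u | f \notin e :: E]) //.
by apply: eq_filter => h; rewrite /= inE negb_or andbC.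
Qed.

End Transpositions.

(** * Necessity: trees *)

Section Trees.
Variable T : finType.
Implicit Types (u v r : seq {perm T}) (x y z a b c d : T) (e f t : {perm T}).

Lemma tperm_neq x y z w : x != y -> x != z -> x != w -> tperm x y != tperm z w.
Proof.
move=> xy xz xw; apply: contraNneq xy => E.
by have := tpermL x y; rewrite E tpermD 1?[_ == x]eq_sym // => ->.
Qed.

Lemma tperm_braid x y z : x != y -> y != z -> x != z ->
  tperm x y * (tperm y z * tperm x y) = tperm y z * (tperm x y * tperm y z).
Proof.
move=> xy yz xz.
have E (s w : T) g : tperm s w * (g * tperm s w) = g ^ tperm s w.
  by rewrite conjgE tpermV.
by rewrite !E !tpermJ !tpermL !tpermR !tpermD // 1?eq_sym // tpermC.
Qed.

Lemma joined_in u x y : joined u x y -> tperm x y \in u.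
Proof. by case/andP. Qed.

Lemma uniform_energy_nseq_mid x y i j s u : j <= i -> odd i = odd j ->
  uniform_energy (s ++ nseq i (tperm x y) ++ u) ->
  uniform_energy (s ++ nseq j (tperm x y) ++ u).
Proof.
move=> ji oij E; apply: (uniform_energy_perm (permEl (perm_catCA _ _ _))).
apply: uniform_energy_nseq ji oij _.
by apply: uniform_energy_perm E; rewrite perm_catCA.
Qed.

(** With e = (x y) and f = (y z), the words eeff and efefef reduce to 1, while fefe and eeefff
    reduce to ef by the braid relation; and ef joins three cycles of V. *)
Lemma adjacent_letters_contra x y z v i j :
    let V := \prod_(f <- v) f in
    y \notin porbit V x -> z \notin porbit V y -> z \notin porbit V x ->
    1 < i -> 1 < j -> odd i = odd j ->
  ~ uniform_energy (nseq i (tperm x y) ++ nseq j (tperm y z) ++ v).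
Proof.
move=> V yx zy zx i2 j2 oij E.
have nxy : x != y by apply: contraNneq yx => <-; apply: porbit_id.
have nyz : y != z by apply: contraNneq zy => <-; apply: porbit_id.
have nxz : x != z by apply: contraNneq zx => <-; apply: porbit_id.
have lt : cycle_energy V < cycle_energy (tperm x y * (tperm y z * V)).
  apply: ltn_trans (cycle_energy_merge_gt zy) (cycle_energy_merge_gt _).
  rewrite porbit_sym porbit_merge // inE porbit_id /= inE porbit_sym (negPf yx).
  by rewrite porbit_sym (negPf zx).
(* The least multiplicity above 1 of the common parity. *)
have [k k2 [q]] : exists2 k, k = 2 \/ k = 3 & uniform_energy
    (nseq k (tperm x y) ++ nseq k (tperm y z) ++ v).
  exists (2 + odd i); first by case: (odd i); [right|left].
  have le m : 1 < m -> 2 + odd m <= m by case: m => [|[|[|m]]] //; lia.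
  apply: (@uniform_energy_nseq_mid y z j); first by rewrite oij le.
    by rewrite oddD oddb oij.
  by apply: (uniform_energy_nseq (le i i2)) E; rewrite oddD oddb.
set e := tperm x y; set f := tperm y z in E * => H.
have {H} P s : perm_eq s (nseq k e ++ nseq k f) ->
    cycle_energy (\prod_(g <- s) g * V) = q.
  by move=> sk; rewrite -big_cat; apply: H; rewrite catA perm_cat2r.
have braid : e * (f * e) = f * (e * f) by apply: tperm_braid.
have ee : e * e = 1 by apply: tperm2.
have ff : f * f = 1 by apply: tperm2.
suff EV : cycle_energy V = cycle_energy (e * (f * V)) by rewrite EV ltnn in lt.
have braidK w : e * (f * (e * w)) = f * (e * (f * w)).
  by rewrite !mulgA -(mulgA e) braid !mulgA.
have eK : involutive (mulg e) by apply: tpermKg.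
have fK : involutive (mulg f) by apply: tpermKg.
case: k2 P => -> P.
  transitivity q; first by rewrite -(P [:: e; e; f; f]) // !big_cons big_nil
    mulg1 eK tperm2 mul1g.
  rewrite -(P [:: f; e; f; e]); last by apply/seq.permP => p /=; lia.
  by rewrite !big_cons big_nil mulg1 braid fK mulgA.
transitivity q.
  rewrite -(P [:: e; f; e; f; e; f]).
    by rewrite !big_cons big_nil mulg1 braidK fK eK tperm2 mul1g.
  apply/seq.permP => p /=; lia.
by rewrite -(P [:: e; e; e; f; f; f]) // !big_cons big_nil mulg1 eK fK mulgA.
Qed.

Lemma bridge_contra u v x y s w : forest u -> joined u x y ->
    {subset v <= u} -> tperm x y \notin v ->
  connect (joined v) x s -> connect (joined v) s w -> connect (joined v) w y -> False.
Proof.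
move=> Fu xy vu nv xs st ty; have := forest_bridge Fu xy vu nv.
by rewrite (connect_trans xs (connect_trans st ty)).
Qed.

Lemma separatesI a b c d N :
    (forall i j, i < j < 4 -> pt a b c d j \notin porbit N (pt a b c d i)) ->
  separates a b c d N.
Proof.
move=> H i j i4 j4; case: ltngtP => // [ij|ji] _; first by rewrite H ?ij.
by rewrite porbit_sym H ?ji.
Qed.

Lemma connect_sub_joined u v x y : {subset v <= u} ->
  connect (joined v) x y -> connect (joined u) x y.
Proof.
by move=> vu; apply: connect_sub => z w zw; apply/connect1/(joined_sub vu).
Qed.

Lemma connect_mem u x y : x != y -> tperm x y \in u -> connect (joined u) x y.
Proof. by move=> nxy xyu; apply: connect1; rewrite /joined nxy. Qed.

(** A cycle of the product through two marked points gives a path in [v] between them. Completed by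
    the other edges of a - b - c - d, it is a detour around one of the three edges, which are
    bridges. *)
Lemma path_separates u v a b c d : forest u -> transpositions u ->
    uniq [:: a; b; c; d] -> joined u a b -> joined u b c -> joined u c d ->
    {subset v <= u} -> tperm a b \notin v -> tperm b c \notin v ->
    tperm c d \notin v ->
  separates a b c d (\prod_(f <- v) f).
Proof.
move=> Fu tu U ab bc cd vu nab nbc ncd.
have tv := transpositions_sub vu tu.
move: U; rewrite /= !inE !negb_or andbT -!andbA => /and5P[Nab Nac Nad Nbc].
move=> /andP[Nbd Ncd].
have sub e f : e \in u -> f \in u -> {subset [:: e, f & v] <= u}.
  by move=> eu fu g; rewrite !inE => /or3P[/eqP->|/eqP->|/vu].
have up e f x y : connect (joined v) x y -> connect (joined [:: e, f & v]) x y.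
  by apply: connect_sub_joined => g gv; rewrite !inE gv !orbT.
have hd1 x y f : x != y -> connect (joined [:: tperm x y, f & v]) x y.
  by move=> nxy; apply: connect_mem => //; rewrite !inE eqxx.
have hd2 x y f : x != y -> connect (joined [:: f, tperm x y & v]) x y.
  by move=> nxy; apply: connect_mem => //; rewrite !inE eqxx orbT.
have sy := connect_joined_sym.
have Bab : tperm a b \notin [:: tperm b c, tperm c d & v].
  by rewrite !inE !negb_or nab !tperm_neq.
have Bbc : tperm b c \notin [:: tperm a b, tperm c d & v].
  rewrite !inE !negb_or nbc andbT [_ == tperm a b]eq_sym.
  by rewrite !tperm_neq // 1?eq_sym.
have Bcd : tperm c d \notin [:: tperm a b, tperm b c & v].
  by rewrite !inE !negb_or ncd [tperm c d]tpermC !tperm_neq // 1?eq_sym.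
have sab := sub _ _ (joined_in bc) (joined_in cd).
have sbc := sub _ _ (joined_in ab) (joined_in cd).
have scd := sub _ _ (joined_in ab) (joined_in bc).
apply: separatesI => i j ij; apply/negP => /(connect_porbit_prod tv).
move: i j ij => [|[|[|i]]] [|[|[|[|j]]]] //=; rewrite ?andbF // => _ /up cij.
- by apply: (bridge_contra Fu ab sab Bab (cij _ _) (connect0 _ _)).
- by apply: (bridge_contra Fu ab sab Bab (cij _ _) (connect0 _ _)); rewrite sy hd1.
- apply: (bridge_contra Fu ab sab Bab (cij _ _)); rewrite sy; first exact: hd2.
  exact: hd1.
- by apply: (bridge_contra Fu bc sbc Bbc (cij _ _) (connect0 _ _)).
- by apply: (bridge_contra Fu bc sbc Bbc (cij _ _) (connect0 _ _)); rewrite sy hd2.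
- by apply: (bridge_contra Fu cd scd Bcd (cij _ _) (connect0 _ _)).
Qed.

(** As for the path. If [v] joins two leaves, the edge from the centre to one of them has a detour
    through the other. *)
Lemma star_separates u v a b c d : forest u -> transpositions u ->
    uniq [:: a; b; c; d] -> joined u a b -> joined u a c -> joined u a d ->
    {subset v <= u} -> tperm a b \notin v -> tperm a c \notin v ->
    tperm a d \notin v ->
  separates a b c d (\prod_(f <- v) f).
Proof.
move=> Fu tu U ab ac ad vu nab nac nad.
have tv := transpositions_sub vu tu.
move: U; rewrite /= !inE !negb_or andbT -!andbA => /and5P[Nab Nac Nad Nbc].
move=> /andP[Nbd Ncd].
have sub e f : e \in u -> f \in u -> {subset [:: e, f & v] <= u}.
  by move=> eu fu g; rewrite !inE => /or3P[/eqP->|/eqP->|/vu].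
have up e f x y : connect (joined v) x y -> connect (joined [:: e, f & v]) x y.
  by apply: connect_sub_joined => g gv; rewrite !inE gv !orbT.
have hd1 x y f : x != y -> connect (joined [:: tperm x y, f & v]) x y.
  by move=> nxy; apply: connect_mem => //; rewrite !inE eqxx.
have hd2 x y f : x != y -> connect (joined [:: f, tperm x y & v]) x y.
  by move=> nxy; apply: connect_mem => //; rewrite !inE eqxx orbT.
have sy := connect_joined_sym.
have Bab : tperm a b \notin [:: tperm a c, tperm a d & v].
  by rewrite !inE !negb_or nab [tperm a b]tpermC !tperm_neq // 1?eq_sym.
have Bac : tperm a c \notin [:: tperm a b, tperm a d & v].
  by rewrite !inE !negb_or nac [tperm a c]tpermC !tperm_neq // 1?eq_sym.
have sab := sub _ _ (joined_in ac) (joined_in ad).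
have sac := sub _ _ (joined_in ab) (joined_in ad).
apply: separatesI => i j ij; apply/negP => /(connect_porbit_prod tv).
move: i j ij => [|[|[|i]]] [|[|[|[|j]]]] //=; rewrite ?andbF // => _ /up cij.
- by apply: (bridge_contra Fu ab sab Bab (cij _ _) (connect0 _ _)).
- by apply: (bridge_contra Fu ac sac Bac (cij _ _) (connect0 _ _)).
- have Bad : tperm a d \notin [:: tperm a b, tperm a c & v].
    by rewrite !inE !negb_or nad [tperm a d]tpermC !tperm_neq // 1?eq_sym.
  have sad := sub _ _ (joined_in ab) (joined_in ac).
  by apply: (bridge_contra Fu ad sad Bad (cij _ _) (connect0 _ _)).
- apply: (bridge_contra Fu ab sab Bab (hd1 a c _ Nac) _ (connect0 _ _)).
  by rewrite sy cij.
- apply: (bridge_contra Fu ab sab Bab (hd2 a d _ Nad) _ (connect0 _ _)).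
  by rewrite sy cij.
- apply: (bridge_contra Fu ac sac Bac (hd2 a d _ Nad) _ (connect0 _ _)).
  by rewrite sy cij.
Qed.

End Trees.

Section TreeContradictions.
Variable T : finType.
Implicit Types (u v r : seq {perm T}) (x y z a b c d : T).

Local Notation mul u x y := (count_mem (tperm x y) u).

Lemma uniform_energy_words a b c d (w0 : word) v :
    uniform_energy ([seq tperm (pt a b c d p.1) (pt a b c d p.2) | p <- w0] ++ v) ->
  exists q, forall w, perm_eq w w0 ->
    cycle_energy (word_perm a b c d w * \prod_(f <- v) f) = q.
Proof.
case=> q H; exists q => w ww0; rewrite -(H _ (perm_cat (perm_map _ ww0) (perm_refl v))).
by rewrite big_cat big_map.
Qed.

(** Lowers three multiplicities within their parity and moves these letters to the front; the other
    letters keep one fixed order, whose product is the right factor in the word lemmas. *)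
Lemma uniform_energy_three u a b c d x y i j k :
    let E := [:: tperm a b; tperm c d; tperm x y] in
    uniq E -> uniform_energy u ->
    i <= mul u a b -> odd i = odd (mul u a b) ->
    j <= mul u c d -> odd j = odd (mul u c d) ->
    k <= mul u x y -> odd k = odd (mul u x y) ->
  uniform_energy (nseq i (tperm a b) ++ nseq j (tperm c d) ++ nseq k (tperm x y)
    ++ [seq f <- u | f \notin E]).
Proof.
move=> E uE Fu il oi jl oj kl ok.
have := uniform_energy_perm (extract_letters u uE) Fu.
rewrite /= cats0 -!catA => H.
apply: uniform_energy_nseq il _ _ => //.
apply: uniform_energy_nseq_mid jl _ _ => //.
by rewrite catA; apply: uniform_energy_nseq_mid kl _ _ => //; rewrite -!catA.
Qed.

Lemma notin_filter u (E : seq {perm T}) t :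
  t \in E -> t \notin [seq f <- u | f \notin E].
Proof. by move=> tE; rewrite mem_filter tE. Qed.

Lemma filter_subset u (p : pred {perm T}) : {subset filter p u <= u}.
Proof. by move=> f; rewrite mem_filter => /andP[]. Qed.

Lemma even_gt1 m : 0 < m -> ~~ odd m -> 1 < m.
Proof. by case: m => [|[|m]]. Qed.

Lemma odd_gt2 m : 1 < m -> odd m -> 2 < m.
Proof. by case: m => [|[|[|m]]]. Qed.

Section Tree.
Variable u : seq {perm T}.
Hypotheses (Fu : forest u) (tu : transpositions u) (Eu : uniform_energy u).

Lemma mul_gt0 x y : joined u x y -> 0 < mul u x y.
Proof. by case/andP; rewrite -has_count has_pred1. Qed.

(** In a forest the remaining letters leave [x], [y], [z] in different cycles, as
    [adjacent_letters_contra] requires. *)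
Lemma forest_adjacent_contra x y z : joined u x y -> joined u y z -> x != z ->
    1 < mul u x y -> 1 < mul u y z -> odd (mul u x y) = odd (mul u y z) ->
  False.
Proof.
move=> xy yz nxz xy2 yz2 oxy; have nxy : x != y by case/andP: xy.
have nyz : y != z by case/andP: yz.
have nef : tperm x y != tperm y z by apply: tperm_neq.
pose E := [:: tperm x y; tperm y z].
have uE : uniq E by rewrite /= inE nef.
have := uniform_energy_perm (extract_letters u uE) Eu.
rewrite /= cats0 -!catA; set v := filter _ u.
have vu : {subset v <= u} by apply: filter_subset.
have tv := transpositions_sub vu tu.
have nev : tperm x y \notin v by apply: notin_filter; rewrite mem_head.
have nfv : tperm y z \notin v by apply: notin_filter; rewrite !inE eqxx orbT.
have toV s w : w \in porbit (\prod_(f <- v) f) s -> connect (joined v) s w.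
  exact: connect_porbit_prod.
apply: adjacent_letters_contra => //; apply/negP => /toV h.
- exact: negP (forest_bridge Fu xy vu nev) h.
- exact: negP (forest_bridge Fu yz vu nfv) h.
(* A path from [x] to [z] avoiding both edges, extended by the edge to [y], would be a detour around
   (x y). *)
- pose v' := tperm y z :: v.
  have v'u : {subset v' <= u}.
    by move=> f; rewrite inE => /orP[/eqP->|/vu//]; case/andP: yz.
  have nev' : tperm x y \notin v' by rewrite inE negb_or nef.
  apply: (bridge_contra Fu xy v'u nev' _ (connect0 _ z)).
    by apply: connect_sub_joined h => f fv; rewrite inE fv orbT.
  by rewrite connect_joined_sym; apply: connect_mem; rewrite ?mem_head.
Qed.

(** Parity reduces the multiplicities to 2, 1, 1. *)
Lemma forest_star_contra a b c d : uniq [:: a; b; c; d] ->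
    joined u a b -> joined u a c -> joined u a d ->
    ~~ odd (mul u a b) -> odd (mul u a c) -> odd (mul u a d) ->
  False.
Proof.
move=> U ab ac ad oab oac oad.
have := U; rewrite /= !inE !negb_or andbT -!andbA => /and5P[Nab Nac Nad Nbc].
move=> /andP[Nbd Ncd].
pose E := [:: tperm a b; tperm a c; tperm a d].
have uE : uniq E.
  have N y z : a != y -> y != z -> tperm a y != tperm a z.
    by move=> ay yz; rewrite [tperm a y]tpermC tperm_neq // eq_sym.
  by rewrite /= !inE !negb_or !N.
have nv t := @notin_filter u E t.
have sV := star_separates Fu tu U ab ac ad (@filter_subset u _)
   (nv _ (mem_nth 1 (isT : 0 < size E))) (nv _ (mem_nth 1 (isT : 1 < size E)))
   (nv _ (mem_nth 1 (isT : 2 < size E))).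
have := mul_gt0 ab; have := mul_gt0 ac; have := mul_gt0 ad => pad pac pab.
have [] := @uniform_energy_words a b c d
  [:: (0, 1); (0, 1); (0, 2); (0, 3)]%N [seq f <- u | f \notin E].
  refine (@uniform_energy_three u a b a c a d 2 1 1 uE Eu
    (even_gt1 pab oab) _ pac _ pad _); by rewrite ?oac ?oad ?(negPf oab).
by move=> q; apply: star_words_contra.
Qed.

(** The first alternative reduces to multiplicities 1, 2, 1, the second to 2, 3, 1 or 2, 3, 2
    according to the parity of the last edge. *)
Lemma forest_path_contra a b c d : uniq [:: a; b; c; d] ->
    joined u a b -> joined u b c -> joined u c d ->
    [\/ [/\ ~~ odd (mul u b c), odd (mul u a b) & odd (mul u c d)] |
        [/\ ~~ odd (mul u a b), odd (mul u b c) & 1 < mul u b c]] ->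
  False.
Proof.
move=> U ab bc cd oP.
have := U; rewrite /= !inE !negb_or andbT -!andbA => /and5P[Nab Nac Nad Nbc].
move=> /andP[Nbd Ncd].
pose E := [:: tperm a b; tperm b c; tperm c d].
have uE : uniq E by rewrite /= !inE !negb_or !tperm_neq.
have nv t := @notin_filter u E t.
have sV := path_separates Fu tu U ab bc cd (@filter_subset u _)
   (nv _ (mem_nth 1 (isT : 0 < size E))) (nv _ (mem_nth 1 (isT : 1 < size E)))
   (nv _ (mem_nth 1 (isT : 2 < size E))).
have := mul_gt0 ab; have := mul_gt0 bc; have := mul_gt0 cd => pcd pbc pab.
have step w0 : uniform_energy
    ([seq tperm (pt a b c d p.1) (pt a b c d p.2) | p <- w0] ++
       [seq f <- u | f \notin E]) ->
    (forall q, (forall w, perm_eq w w0 -> cycle_energy (word_perm a b c d w *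
      \prod_(f <- [seq f <- u | f \notin E]) f) = q) -> False) -> False.
  by move=> /uniform_energy_words[q Hq]; apply; apply: Hq.
case: oP => -[].
  move=> obc oab ocd; apply: (step [:: (1, 2); (1, 2); (0, 1); (2, 3)]%N).
    have : uniform_energy (nseq 1 (tperm a b) ++ nseq 2 (tperm b c) ++
      nseq 1 (tperm c d) ++ [seq f <- u | f \notin E]).
      refine (uniform_energy_three uE Eu pab _ (even_gt1 pbc obc) _ pcd _);
        by rewrite ?oab ?ocd ?(negPf obc).
    by apply: uniform_energy_perm; rewrite (perm_catCA [:: _] [:: _; _]).
  by move=> q; apply: middle_words_contra.
move=> oab obc bc2; have [ocd|ocd] := boolP (odd (mul u c d)).
  apply: (step [:: (0, 1); (0, 1); (1, 2); (1, 2); (1, 2); (2, 3)]%N).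
    refine (@uniform_energy_three u a b b c c d 2 3 1 uE Eu (even_gt1 pab oab) _
      (odd_gt2 bc2 obc) _ pcd _); by rewrite ?obc ?ocd ?(negPf oab).
  by move=> q; apply: path231_words_contra.
apply: (step [:: (0, 1); (0, 1); (1, 2); (1, 2); (1, 2); (2, 3); (2, 3)]%N).
  refine (@uniform_energy_three u a b b c c d 2 3 2 uE Eu (even_gt1 pab oab) _
    (odd_gt2 bc2 obc) _ (even_gt1 pcd ocd) _);
    by rewrite ?obc ?(negPf oab) ?(negPf ocd).
by move=> q; apply: path232_words_contra.
Qed.

End Tree.
End TreeContradictions.

(** * Necessity: graphs with a cycle *)

Section PathProducts.
Variable T : finType.
Implicit Types (x y z : T) (p : seq T).

Definition path_edges x p : seq {perm T} := pairmap (@tperm T) x p.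

Lemma path_edges_out x p z : z \notin x :: p ->
  (\prod_(f <- path_edges x p) f) z = z.
Proof.
elim: p x => [|y p IH] x; first by rewrite big_nil perm1.
rewrite inE negb_or => /andP[nzx zp]; rewrite big_cons permM tpermD ?IH //.
  by rewrite eq_sym.
by move: zp; rewrite inE negb_or eq_sym => /andP[].
Qed.

Lemma path_edges_last x p : uniq (x :: p) ->
  (\prod_(f <- path_edges x p) f) x = last x p.
Proof.
elim: p x => [|y p IH] x; first by rewrite big_nil perm1.
by case/andP=> _ up; rewrite big_cons permM tpermL IH.
Qed.

(** Moving the first edge past the product of the others conjugates it; that product fixes [x] and
    carries [y] to the end of the path. *)
Lemma path_edges_cons x y p : uniq [:: x, y & p] ->
  \prod_(f <- path_edges x (y :: p)) f =
  (\prod_(f <- path_edges y p) f) * tperm x (last y p).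
Proof.
case/andP=> xp up; rewrite big_cons -(path_edges_last up) conjgC tpermJ.
by rewrite (path_edges_out xp).
Qed.

Lemma mem_path_edges x p u : path (joined u) x p -> {subset path_edges x p <= u}.
Proof.
elim: p x => //= y p IH x /andP[/andP[_ xy] /IH py] f.
by rewrite inE => /orP[/eqP->|/py].
Qed.

Lemma path_edges_moves x p z f : z \notin x :: p -> f \in path_edges x p -> f z = z.
Proof.
elim: p x => //= y p IH x; rewrite inE negb_or => /andP[nzx zp].
rewrite inE => /orP[/eqP->|]; last exact: IH.
by move: zp; rewrite inE negb_or => /andP[nzy _]; rewrite tpermD // eq_sym.
Qed.

Lemma uniq_path_edges x p : uniq (x :: p) -> uniq (path_edges x p).
Proof.
elim: p x => //= y p IH x /andP[xp up]; rewrite IH // andbT.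
apply/negP => /(path_edges_moves xp); rewrite tpermL => yx.
by rewrite yx mem_head in xp.
Qed.

End PathProducts.

Lemma uniq_sub_perm (T : eqType) (E u : seq T) : uniq E -> {subset E <= u} ->
  exists v, perm_eq u (E ++ v).
Proof.
elim: E => [|e E IH] /=; first by exists u.
case/andP=> eE uE Eu; have [|v uv] := IH uE.
  by move=> f fE; apply: Eu; rewrite inE fE orbT.
have : e \in E ++ v by rewrite -(perm_mem uv) Eu // mem_head.
rewrite mem_cat (negPf eE) /= => ev; exists (rem e v).
rewrite (perm_trans uv) // -cat1s perm_sym (perm_catCA [:: e]) perm_cat2l.
by rewrite perm_sym perm_to_rem.
Qed.

Section Cycle.
Variable T : finType.
Implicit Types (x y z a b c d : T).
Variable u : seq {perm T}.
Hypothesis Eu : uniform_energy u.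

(** Each witness permutation is the product of the triangle and the extra edge in some order, so all
    of them would give equal energies. *)
Lemma triangle_contra a b c d : uniq [:: a; b; c; d] ->
  joined u a b -> joined u b c -> joined u a c -> joined u a d -> False.
Proof.
move=> U ab bc ac ad.
have := U; rewrite /= !inE !negb_or andbT -!andbA => /and5P[Nab Nac Nad Nbc].
move=> /andP[Nbd Ncd].
pose w0 : word := [:: (0, 1); (1, 2); (0, 2); (0, 3)]%N.
pose E := [:: tperm a b; tperm b c; tperm a c; tperm a d].
have N y z : a != y -> y != z -> tperm a y != tperm a z.
  by move=> ay yz; rewrite [tperm a y]tpermC tperm_neq // eq_sym.
have N' y : a != y -> tperm b c != tperm a y.
  by move=> ay; rewrite eq_sym tperm_neq.
have uE : uniq E by rewrite /= !inE !negb_or tperm_neq // !N // !N'.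
have sE : {subset E <= u}.
  by move=> f; rewrite !inE => /or4P[] /eqP->; apply: joined_in.
have [v uv] := uniq_sub_perm uE sE.
have [q H] := uniform_energy_words (w0 := w0) (a := a) (b := b) (c := c) (d := d)
  (uniform_energy_perm uv Eu).
apply: (witness_words_contra U (W := \prod_(f <- v) f) (q := q)) => w ww.
(* Checked over all rearrangements of the four letters. *)
have /allP/(_ _ ww)/hasP[w' w'w0 sw] : all (fun w => has (same_act w)
    (permutations w0)) witness_words by vm_compute.
rewrite mem_permutations in w'w0.
have vw' : valid_word w' by rewrite /valid_word (perm_all _ w'w0).
have vw : valid_word w.
  by have /allP/(_ _ ww) : all valid_word witness_words by vm_compute.
by rewrite (eq_word_perm U vw vw' sw) H.
Qed.

(* The edges d - w - .. - a of the cycle, multiplied in this order, give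
   g * (d a), where the product g of those between w and a fixes b, c, d.
   Moving g around the cyclic word leaves words in the edges of the
   4-cycle a b c d, in which (d a) precedes (a b). *)
Lemma long_cycle_contra a b c d s : ~ ucycle (joined u) [:: a, b, c, d & s].
Proof.
move=> /andP[cyc U].
have U4 : uniq [:: a; b; c; d] by apply: subseq_uniq U; rewrite /= !eqxx sub0seq.
(* The way back from [d] to [a] has at least one step; for a 4-cycle it is [a] itself. *)
have [w [p [wpE lastE]]] : exists w p, rcons s a = w :: p /\ last w p = a.
  case: s {U cyc} => [|w s]; first by exists a, [::].
  by exists w, (rcons s a); rewrite last_rcons.
have /and4P[ab bc cd dp] : [&& joined u a b, joined u b c, joined u c d &
    path (joined u) d (w :: p)] by rewrite -wpE.
have Ubcd : uniq [:: b, c, d, w & p].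
  rewrite -wpE -!rcons_cons rcons_uniq; move: U.
  by rewrite -[[:: b, c, d & s]]/(behead [:: a, b, c, d & s]) /=.
have Udp : uniq [:: d, w & p] by move: Ubcd => /= /and3P[].
have [nb nc] : b \notin [:: d, w & p] /\ c \notin [:: d, w & p].
  move: Ubcd; rewrite cons_uniq inE negb_or => /andP[/andP[_ ->]].
  by case/andP=> ->.
have := U4; rewrite /= !inE !negb_or andbT -!andbA => /and5P[Nab Nac Nad Nbc].
move=> /andP[Nbd Ncd].
pose E3 := [:: tperm a b; tperm b c; tperm c d].
have off z (f : {perm T}) : z \notin [:: d, w & p] -> f z != z ->
    f \notin path_edges d (w :: p).
  by move=> zp; apply: contra => /(path_edges_moves zp)->.
have uE : uniq (E3 ++ path_edges d (w :: p)).
  rewrite cat_uniq uniq_path_edges // andbT; apply/andP; split.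
    by rewrite /= !inE !negb_or !tperm_neq.
  apply/hasPn => f fp; rewrite !inE; apply/negP => /or3P[]/eqP fE; move: fp; rewrite fE.
  - by apply/negP/(off b); rewrite // tpermR.
  - by apply/negP/(off b); rewrite // tpermL eq_sym.
  - by apply/negP/(off c); rewrite // tpermL eq_sym.
have sE : {subset E3 ++ path_edges d (w :: p) <= u}.
  move=> f; rewrite mem_cat => /orP[|]; last exact: mem_path_edges.
  by rewrite !inE => /or3P[] /eqP->; apply: joined_in.
have [v uv] := uniq_sub_perm uE sE.
have [q H] := uniform_energy_perm uv Eu.
pose V := \prod_(f <- v) f; pose g := \prod_(f <- path_edges w p) f.
have gB : \prod_(f <- path_edges d (w :: p)) f = g * tperm a d.
  by rewrite path_edges_cons // lastE tpermC.
have g_out z : z \notin w :: p -> g z = z by apply: path_edges_out.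
have tl z : z \notin [:: d, w & p] -> z \notin w :: p.
  by rewrite in_cons negb_or => /andP[].
have gb : g b = b by apply/g_out/tl.
have gc : g c = c by apply/g_out/tl.
have gd : g d = d by apply: g_out; case/andP: Udp.
pose wp := word_perm a b c d.
(* The edges (b c) and (c d) commute with [g], which fixes their endpoints. *)
have gcomm al : all (mem [:: (1, 2); (2, 3)]%N) al -> wp al * g = g * wp al.
  rewrite /wp /word_perm; elim: al => [|e al IH] /=.
    by rewrite big_nil mul1g mulg1.
  case/andP=> el /IH {}IH; rewrite big_cons -mulgA IH !mulgA; congr (_ * _).
  rewrite conjgC tpermJ; move: el; rewrite !inE /pt => /orP[]/eqP-> /=.
    by rewrite gb gc.
  by rewrite gc gd.
(* The order is [al], the way back, [be], [v]. Then [g] passes to the left of [al] and from there to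
   the far right by cyclic rotation, so it joins [V] in one fixed right factor. *)
have key al be : perm_eq (al ++ be) [:: (0, 1); (1, 2); (2, 3)]%N ->
    all (mem [:: (1, 2); (2, 3)]%N) al ->
    cycle_energy (wp (al ++ (0, 3)%N :: be) * (V * g)) = q.
  move=> ab3 /gcomm gal.
  pose L := map (fun p => tperm (pt a b c d p.1) (pt a b c d p.2)).
  rewrite -(H (L al ++ path_edges d (w :: p) ++ L be ++ v)); last first.
    apply: (@perm_trans _ ((L al ++ L be) ++ path_edges d (w :: p) ++ v)).
      by rewrite -catA perm_cat2l perm_catCA.
    by rewrite -[X in perm_eq _ X]catA perm_cat2r -map_cat (perm_map _ ab3).
  have -> : wp (al ++ (0, 3)%N :: be) = wp al * (tperm a d * wp be).
    by rewrite /wp /word_perm big_cat big_cons.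
  rewrite !big_cat /= gB -/V !big_map.
  rewrite -/(word_perm a b c d al) -/(word_perm a b c d be) -/wp.
  by rewrite !mulgA gal -!mulgA [RHS]cycle_energyC !mulgA.
apply: (witness_words_contra U4 (W := V * g) (q := q)) => x xw.
(* Each witness permutation is the action of [al (0,3) be] for one of these splits; (0,1) has to
   stay in [be], since it does not in general commute with [g]. *)
pose pairs : seq (word * word) :=
  [:: ([::], [:: (0, 1); (2, 3); (1, 2)]); ([:: (1, 2)], [:: (0, 1); (2, 3)]);
      ([:: (2, 3); (1, 2)], [:: (0, 1)]); ([:: (1, 2); (2, 3)], [:: (0, 1)]);
      ([:: (2, 3)], [:: (0, 1); (1, 2)])]%N.
pose good := [pred ab : word * word | [&& perm_eq (ab.1 ++ ab.2)
    [:: (0, 1); (1, 2); (2, 3)]%N, all (mem [:: (1, 2); (2, 3)]%N) ab.1 &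
    valid_word (ab.1 ++ (0, 3)%N :: ab.2)]].
have /allP gP : all good pairs by vm_compute.
have /allP/(_ _ xw)/hasP[[al be] /gP/and3P[pe al23 vab] sx] :
    all (fun w1 => has (fun ab => same_act w1 (ab.1 ++ (0, 3)%N :: ab.2)) pairs)
      witness_words by vm_compute.
have vx : valid_word x.
  by have /allP/(_ _ xw) : all valid_word witness_words by vm_compute.
by rewrite (eq_word_perm U4 vx vab sx) key.
Qed.

End Cycle.

(** * Acyclicity, and counting components of a product *)

Section ForestProducts.
Variable T : finType.
Implicit Types (u v r : seq {perm T}) (x y z a b c d w : T) (f t : {perm T}).

Lemma exists_notin (A : {set T}) : #|A| < #|T| -> exists x, x \notin A.
Proof.
move=> ltA; have /subsetPn[x _ xA] : ~~ ([set: T] \subset A); last by exists x.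
by apply: contraL ltA => /subset_leq_card; rewrite cardsT -leqNgt.
Qed.

Lemma cards3_le x y z : #|[set x; y; z]| <= 3.
Proof.
rewrite (leq_trans (leq_card_setU _ _)) // cards1 addn1 ltnS cards2.
by case: eqP.
Qed.

Lemma connect_exit (e : rel T) (A : {set T}) x y :
    connect e x y -> x \in A -> y \notin A ->
  exists s q, [/\ s \in A, q \notin A & e s q].
Proof.
case/connectP=> p; elim: p x => [|s p IH] x /=; first by move=> _ -> ->.
case/andP=> xs sp yl xA yA; have [sA|sA] := boolP (s \in A).
  exact: IH sp yl sA yA.
by exists x, s.
Qed.

(** Cycles of length at least 4 are excluded directly. With a fourth point and connectedness, some
    vertex of a triangle has a neighbor outside it. *)
Lemma uniform_energy_forest u : uniform_energy u ->
  (forall x y, connect (joined u) x y) -> 3 < #|T| -> forest u.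
Proof.
move=> Eu cu T4 [|a [|b [|c [|d s]]]] // _; last exact: long_cycle_contra.
case/andP=> /and4P[ab bc ca _]; rewrite /= !inE negb_or !andbT.
case/andP=> /andP[nab nac] nbc; rewrite joined_sym in ca.
pose A := [set a; b; c].
have [w wA] := exists_notin (leq_ltn_trans (cards3_le a b c) T4).
have aA : a \in A by rewrite !inE eqxx.
have [s [{wA}w [sA wA sw]]] := connect_exit (cu a w) aA wA.
move: wA; rewrite !inE !negb_or -andbA => /and3P[wa wb wc].
(* The triangle is relabelled so that the vertex with the outside neighbor comes first. *)
move: sA; rewrite !inE -orbA => /or3P[] /eqP se; rewrite {}se {s} in sw.
- apply: (triangle_contra Eu (a := a) (b := b) (c := c) (d := w)) => //.
  by rewrite /= !inE !negb_or nab nac nbc ![_ == w]eq_sym wa wb wc.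
- apply: (triangle_contra Eu (a := b) (b := c) (c := a) (d := w)) => //.
  + by rewrite /= !inE !negb_or nbc ![_ == a]eq_sym nab nac ![_ == w]eq_sym wa wb wc.
  + by rewrite joined_sym.
  + by rewrite joined_sym.
- apply: (triangle_contra Eu (a := c) (b := a) (c := b) (d := w)) => //.
  + by rewrite /= !inE !negb_or nab ![_ == w]eq_sym wa wb wc ![c == _]eq_sym nac nbc.
  + by rewrite joined_sym.
  + by rewrite joined_sym.
Qed.

Lemma prod_invariant (A : Type) (L : T -> A) r z :
  (forall t x, t \in r -> L (t x) = L x) -> L ((\prod_(f <- r) f) z) = L z.
Proof.
elim: r z => [|t r IH] z H; first by rewrite big_nil perm1.
rewrite big_cons permM IH ?H ?mem_head // => f x fr.
by rewrite H // inE fr orbT.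
Qed.

(* The number of classes [lab @: T] drops by at most one with every letter;
   when it always drops, every letter merges two cycles. *)
Lemma component_labels r : transpositions r -> exists lab : T -> T,
  [/\ forall t z, t \in r -> lab (t z) = lab z,
      #|T| <= #|lab @: T| + size r,
      #|T| = (#|lab @: T| + size r)%N -> forall x y, lab x = lab y ->
        y \in porbit (\prod_(f <- r) f) x,
      forall z, connect (joined r) z (lab z)
    & uniq r -> forest r -> #|T| = (#|lab @: T| + size r)%N].
Proof.
elim: r => [_|t r IH tr].
  have E : #|id @: T| = #|T| by apply: card_imset.
  exists id; split=> //=; rewrite ?addn0 ?E //; by move=> _ x y ->; apply: porbit_id.
have tr' : transpositions r.
  by apply: transpositions_sub tr => f fr; rewrite inE fr orbT.
have [lab [I1 I2 I3 I4 I5]] := IH tr'; have [x [y [nxy Et]]] := tr t (mem_head _ _).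
have sub : {subset r <= t :: r} by move=> f fr; rewrite inE fr orbT.
have xyj : joined (t :: r) x y by rewrite /joined nxy Et mem_head.
have lab_prod g z : g \in porbit (\prod_(f <- r) f) z -> lab g = lab z.
  case/porbitP=> i ->; elim: i => [|i Ii]; first by rewrite perm1.
  by rewrite expgSr permM prod_invariant.
(* If the labels agree the classes stay as they are; equality in the count is then impossible, and
   in a forest without repeated letters the bridge property excludes this case. *)
have [exy|nlab] := eqVneq (lab x) (lab y).
  exists lab; split=> [s z|||z|].
  - rewrite inE => /orP[/eqP->|/I1//]; rewrite Et.
    by case: tpermP => // ->.
  - by rewrite (leq_trans I2) // leq_add2l.
  - by move=> /= E; move: I2; rewrite E addnS ltnn.
  - exact: connect_sub_joined sub (I4 z).
  - rewrite /= {1}Et => /andP[tN ur] Fr.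
    have /negP[] := forest_bridge Fr xyj sub tN.
    apply: connect_trans (I4 x) _; rewrite exy connect_joined_sym; exact: I4.
(* The class of [y] is absorbed into that of [x]. *)
pose lab' z := if lab z == lab y then lab x else lab z.
have le1 : #|lab @: T| <= #|lab' @: T|.+1.
  rewrite -add1n -(cards1 (lab y)); apply: leq_trans (leq_card_setU _ _).
  apply/subset_leq_card/subsetP=> _ /imsetP[z _ ->]; rewrite !inE.
  have [//|nz] := eqVneq (lab z) (lab y).
  by apply/imsetP; exists z; rewrite // /lab' (negPf nz).
have yx : y \notin porbit (\prod_(f <- r) f) x.
  by apply: contra nlab => /lab_prod->.
exists lab'; split=> [s z|||z|].
- rewrite inE => /orP[/eqP->|/I1]; last by rewrite /lab' => ->.
  by rewrite Et; case: tpermP => // ->; rewrite /lab' eqxx (negPf nlab).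
- by rewrite /= addnS -addSn (leq_trans I2) // leq_add2r.
- rewrite /= addnS -addSn => E.
  have {}E : #|T| = (#|lab @: T| + size r)%N.
    by apply/eqP; rewrite eqn_leq I2 {1}E leq_add2r.
  have {}I3 := I3 E; move=> a b; rewrite big_cons Et porbit_merge // inE.
  have toP z s : lab z = lab s -> z \in porbit (\prod_(f <- r) f) s by move/esym/I3.
  have fromP z s : (z \in porbit (\prod_(f <- r) f) s) = (lab z == lab s).
    by apply/idP/eqP => [/lab_prod|/toP].
  rewrite /lab' !fromP.
  have [ey|ny] := eqVneq (lab a) (lab y).
    rewrite orbT inE !fromP; case: (lab b =P lab y) => [_ _|_ ->].
      by rewrite orbT.
    by rewrite eqxx.
  rewrite orbF; have [ex|nx] := eqVneq (lab a) (lab x).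
    rewrite inE !fromP; case: (lab b =P lab y) => [_ _|_ <-].
      by rewrite orbT.
    by rewrite ex eqxx.
  case: (lab b =P lab y) => [_ E1|_ E1]; first by rewrite E1 eqxx in nx.
  by rewrite fromP E1.
- have up p q : connect (joined r) p q -> connect (joined (t :: r)) p q.
    exact: connect_sub_joined sub.
  rewrite /lab'; case: eqP => [ez|_]; last exact: up.
  apply: connect_trans (up _ _ (I4 z)) _; rewrite ez.
  apply: connect_trans (up _ _ (I4 x)).
  apply: (@connect_trans _ _ y); first by rewrite connect_joined_sym up.
  by rewrite connect_joined_sym connect1.
- case/andP=> tN ur Fr.
  have {}I5 : #|T| = (#|lab @: T| + size r)%N.
    apply: I5 => // c c3 /andP[cc uc]; apply: (Fr c c3); rewrite /ucycle uc andbT.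
    by case: c cc {uc c3} => //= p c; apply: sub_path; apply: joined_sub.
  apply/eqP; rewrite /= addnS -addSn eqn_leq {1}I5 leq_add2r le1 /=.
  (* [lab y] is no value of [lab'], so the number of classes does drop. *)
  rewrite I5 leq_add2r (cardsD1 (lab y) (lab @: T)) imset_f // add1n ltnS.
  apply/subset_leq_card/subsetP=> _ /imsetP[z _ ->]; rewrite !inE /lab'.
  by case: ifP => [_|/negbT->]; rewrite ?nlab imset_f.
Qed.

End ForestProducts.

(** * Sufficiency *)

Section Conjugacy.
Variable T : finType.
Implicit Types (S : {set T}) (g h : {perm T}) (x y z : T).

(** A single cycle on S; for the empty set and for singletons this is the identity. *)
Definition cycle_on S g :=
  (forall z, z \notin S -> g z = z) /\
  (forall y z, y \in S -> z \in S -> z \in porbit g y).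

Lemma cycle_on_porbit S g x : cycle_on S g -> x \in S -> porbit g x = S.
Proof.
case=> fixg trg xS; apply/eqP; rewrite eqEsubset; apply/andP; split.
  apply: porbit_sub xS => z zS; apply: contraLR zS => gzS.
  by rewrite -(perm_inj (fixg _ gzS)).
by apply/subsetP=> z; apply: trg.
Qed.

(** The two cycles are lined up at a common point [x]: the conjugating permutation sends g^i x to
    h^i x and fixes the points off [S]. *)
Lemma cycle_on_conj S g h : cycle_on S g -> cycle_on S h -> exists s, h = g ^ s.
Proof.
move=> cg ch; have [S0|[x xS]] := set_0Vmem S.
  exists 1; rewrite conjg1; apply/permP => z.
  by rewrite (proj1 cg) ?(proj1 ch) ?S0 ?inE.
pose tr k := traject k x #|S|.
pose s (k l : {perm T}) z := if z \in S then iter (index z (tr k)) l x else z.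
have trP k z : cycle_on S k -> z \in S ->
    index z (tr k) < #|S| /\ iter (index z (tr k)) k x = z.
  move=> ck zS; have pS := cycle_on_porbit ck xS.
  have zt : z \in tr k by rewrite /tr -pS -porbit_traject pS.
  have lt : index z (tr k) < #|S|.
    by rewrite -[X in _ < X](size_traject k x) index_mem.
  by split; rewrite // -(nth_traject k lt x) nth_index.
have trI k i : cycle_on S k -> i < #|S| -> index (iter i k x) (tr k) = i.
  move=> ck iS; have pS := cycle_on_porbit ck xS.
  rewrite -(nth_traject k iS x) index_uniq ?size_traject //.
  by rewrite /tr -pS uniq_traject_porbit.
have iter_in k i : cycle_on S k -> iter i k x \in S.
  by move=> ck; rewrite -(cycle_on_porbit ck xS) -permX mem_porbit.
have iter_full k : cycle_on S k -> iter #|S| k x = x.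
  by move=> ck; rewrite -(cycle_on_porbit ck xS) iter_porbit.
have sK k l : cycle_on S k -> cycle_on S l -> cancel (s k l) (s l k).
  move=> ck cl z; rewrite /s; have [zS|zS] := boolP (z \in S); last first.
    by rewrite (negPf zS).
  by have [lt E] := trP k z ck zS; rewrite iter_in // trI.
pose p := perm (can_inj (sK g h cg ch)); exists p.
apply/permP => z; rewrite -[z in RHS](permKV p) permJ; set y := p^-1 z.
have -> : z = p y by rewrite permKV.
rewrite !permE /s; have [yS|yS] := boolP (y \in S); last first.
  by rewrite (proj1 cg) // (negPf yS) (proj1 ch).
have [lt E] := trP g y cg yS.
have -> : g y = iter (index y (tr g)).+1 g x by rewrite /= E.
(* At the last index the next iterate wraps round to index 0. *)
rewrite iter_in // -iterS; move: lt; rewrite leq_eqVlt.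
case/orP=> [/eqP->|lt]; last by rewrite trI.
by rewrite !iter_full // (trI g 0) // card_gt0; apply/set0Pn; exists x.
Qed.

End Conjugacy.

Section Normalization.
Variable T : finType.
Implicit Types (r : seq {perm T}) (e f g t : {perm T}).

Lemma commute_factor e r : (forall f, f \in r -> f != e -> f * e = e * f) ->
  \prod_(f <- r) f = e ^+ (count_mem e r) * \prod_(f <- filter (predC1 e) r) f.
Proof.
elim: r => [|f r IH] H; first by rewrite !big_nil mulg1.
have {}IH := IH (fun h hr => H h (mem_behead (s := f :: r) hr)).
rewrite big_cons {}IH /=; have [->|nfe] := eqVneq f e; first by rewrite expgS mulgA.
rewrite big_cons add0n !mulgA; congr (_ * _).
by apply: commuteX; apply: H; rewrite ?mem_head.
Qed.

(* With r = p ++ g :: q, the copies of e in p and in q can be moved to the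
   outside, where conjugation makes them cancel. *)
Lemma conj_remove_even e g r : e * e = 1 -> ~~ odd (count_mem e r) ->
    count_mem g r <= 1%N -> g != e ->
    (forall f, f \in r -> f != g -> f != e -> f * e = e * f) ->
  exists s, \prod_(f <- r) f = (\prod_(f <- filter (predC1 e) r) f) ^ s.
Proof.
move=> ee; have eX k : ~~ odd k -> e ^+ k = 1.
  move=> ok; rewrite -(odd_double_half k) (negPf ok) add0n -mul2n expgM.
  by rewrite expgS expg1 ee expg1n.
(* Without [g], every letter commutes with [e], and the even power of [e] is trivial. *)
case gr: (g \in r); last first.
  move=> oe _ _ H; exists 1; rewrite conjg1 (commute_factor (e := e)) ?eX ?mul1g //.
  by move=> f fr nfe; apply: H => //; apply: contraFneq gr => <-.
case/splitPr: {r}gr => p q.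
rewrite !count_cat /= eqxx add1n addnS ltnS leqn0 addn_eq0 => + /andP[gp gq] nge H.
rewrite (negPf nge) add0n => oe.
have ngr s : count_mem g s == 0%N -> g \notin s by move/eqP/count_memPn.
have hp : \prod_(f <- p) f = e ^+ count_mem e p * \prod_(f <- filter (predC1 e) p) f.
  apply: commute_factor => f fp nfe; apply: H => //; first by rewrite mem_cat fp.
  by apply: contraTneq fp => ->; apply: ngr.
have cq f : f \in q -> f != e -> f * e = e * f.
  move=> fq nfe; apply: H => //; first by rewrite mem_cat inE fq !orbT.
  by apply: contraTneq fq => ->; apply: ngr.
have hq := commute_factor cq.
have {}hq : \prod_(f <- q) f =
    (\prod_(f <- filter (predC1 e) q) f) * e ^+ count_mem e q.
  rewrite hq; apply: commute_sym; apply: commuteX.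
  elim: (q) cq => [|f s IH] cs /=; first by rewrite big_nil /commute mul1g mulg1.
  have {}IH : commute (\prod_(h <- filter (predC1 e) s) h) e.
    by apply: IH => h hs; apply: cs; rewrite inE hs orbT.
  case: eqVneq => //= nfe; rewrite big_cons.
  apply/commute_sym/commuteM; apply: commute_sym => //.
  by apply: cs; rewrite ?mem_head.
(* The product is e^i P g Q e^j with i + j even, so e^j is the inverse of e^i. *)
exists (e ^- count_mem e p).
rewrite filter_cat /= nge !big_cat !big_cons /= hp hq conjgE invgK !mulgA.
congr (_ * _).
by apply/eqP; rewrite eq_sym eq_invg_mul -expgD eX.
Qed.

(* Pushing the letters in M to the right conjugates the other letters by
   elements of <M>, and the letters in M then cancel in pairs. *)
Lemma push_commuting (M : pred {perm T}) r :
    transpositions r ->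
    (forall f h, f \in r -> h \in r -> M f -> M h -> f * h = h * f) ->
  exists w F, [/\ \prod_(f <- r) f = (\prod_(f <- w) f) * (\prod_(f <- F) f),
    size w = count (predC M) r,
    uniq F /\ (forall f, (f \in F) = [&& f \in r, M f & odd (count_mem f r)]),
    transpositions w
  & forall (A : Type) (L : T -> A),
      (forall f z, f \in w -> L (f z) = L z) ->
      (forall f z, f \in r -> M f -> L (f z) = L z) ->
      forall f z, f \in r -> L (f z) = L z].
Proof.
elim: r => [|t r IH] tr cM; first by exists [::], [::]; rewrite big_nil mulg1; split.
have sub f : f \in r -> f \in t :: r by rewrite inE orbC => ->.
have tr' : transpositions r by apply: transpositions_sub tr.
have cM' f h : f \in r -> h \in r -> M f -> M h -> f * h = h * f.
  by move=> fr hr; apply: cM; apply: sub.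
have {IH cM'} [w [F [Er sw [uF mF] tw Lw]]] := IH tr' cM'.
have [a [b [nab Et]]] := tr t (mem_head _ _).
have tt : t * t = 1 by rewrite Et tperm2.
have tV : t^-1 = t by rewrite Et tpermV.
case Mt: (M t); last first.
  exists (t :: w), F; split.
  - by rewrite !big_cons Er mulgA.
  - by rewrite /= sw Mt.
  - split=> // f; rewrite mF inE /=; case: eqVneq => [->|]; last by [].
    by rewrite Mt !andbF.
  - by move=> f; rewrite inE => /orP[/eqP->|/tw//]; exists a, b.
  - move=> A L H1 H2 f z; rewrite inE => /orP[/eqP->|fr].
      by rewrite H1 ?mem_head.
    apply: Lw fr => g y gw; first by apply: H1; rewrite inE gw orbT.
    by apply: H2; apply: sub.
(* Moving [t] to the right of [w] conjugates every letter of [w]. *)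
pose w' := [seq f ^ t | f <- w].
have Ew' : t * \prod_(f <- w) f = (\prod_(f <- w') f) * t.
  rewrite big_map; elim: (w) => [|f s IH]; first by rewrite !big_nil mulg1 mul1g.
  by rewrite !big_cons -mulgA -IH conjgE tV -!mulgA (mulgA t t) tt mul1g.
have tw' : transpositions w'.
  move=> _ /mapP[f /tw[c [d [ncd ->]]] ->].
  by exists (t c), (t d); rewrite tpermJ (inj_eq perm_inj).
(* Labels express connectivity: as [t] preserves them, invariance under the conjugated letters is
   invariance under the original ones, so the rewriting disconnects nothing. *)
have Lw' (A : Type) (L : T -> A) :
      (forall f z, f \in w' -> L (f z) = L z) ->
      (forall f z, f \in t :: r -> M f -> L (f z) = L z) ->
      forall f z, f \in t :: r -> L (f z) = L z.
  move=> H1 H2 f z; rewrite inE => /orP[/eqP->|fr]; first by rewrite H2 ?mem_head.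
  have Lt y : L (t y) = L y by rewrite H2 ?mem_head.
  apply: Lw fr => g y gw; last by apply: H2; apply: sub.
  have := H1 (g ^ t) (t y) (map_f _ gw).
  by rewrite conjgE tV !permM !Lt -[t (t y)]permM tt perm1.
have sw' : size w' = count (predC M) (t :: r) by rewrite size_map /= Mt.
have cF h : h \in F -> h * t = t * h.
  by rewrite mF => /and3P[hr Mh _]; apply: cM; rewrite ?mem_head ?sub.
(* A copy of [t] already in [F] commutes with the rest of [F] and cancels the new one. *)
case tF: (t \in F).
  exists w', (rem t F); split=> //.
    rewrite big_cons Er mulgA Ew' -mulgA; congr (_ * _).
    elim: (F) tF cF => //= f s IH; rewrite inE big_cons.
    case: eqVneq => [<- _ _|_ /= ts cs].
      by rewrite mulgA tt mul1g.
    rewrite big_cons mulgA -cs ?mem_head // -mulgA IH // => h hs.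
    by apply: cs; rewrite inE hs orbT.
  split; first exact: rem_uniq.
  move=> f; rewrite mem_rem_uniq // !inE mF /=; move: tF; rewrite mF => /and3P[_ _ ot].
  by case: eqVneq => [->|//]; rewrite /= ot !andbF.
exists w', (t :: F); split=> //.
  by rewrite !big_cons Er mulgA Ew' -mulgA.
split; first by rewrite /= tF uF.
move=> f; rewrite !inE mF /=; case: (f =P t) => [->|] /=; last first.
  by move=> nft; rewrite [t == f]eq_sym; case: eqP.
move: tF; rewrite mF Mt eqxx /=; case tr0: (t \in r) => /=; first by move=> ->.
by move/negbT/count_memPn: tr0 => ->.
Qed.

End Normalization.

Section Sufficiency.
Variable T : finType.
Implicit Types (r : seq {perm T}) (x y z a b c d : T) (f : {perm T}).
Variable u : seq {perm T}.

Local Notation mul u x y := (count_mem (tperm x y) u).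

Hypotheses (Fu : forest u) (tu : transpositions u).
Hypothesis connected_u : forall x y, connect (joined u) x y.
Hypothesis nonsimple_u : forall x y z, joined u x y -> joined u x z ->
  1 < mul u x y -> 1 < mul u x z -> y = z.
Hypothesis even_u : forall x y, joined u x y -> ~~ odd (mul u x y) ->
  exists v w z, [/\ (v, w) = (x, y) \/ (v, w) = (y, x),
    forall z', joined u v z' -> z' = w, z != v, joined u w z
    & forall z', joined u w z' -> z' = v \/ z' = z].

Definition odd_support := [set x | [exists y, joined u x y && odd (mul u x y)]].

Lemma odd_supportP x :
  reflect (exists2 y, joined u x y & odd (mul u x y)) (x \in odd_support).
Proof.
rewrite inE; apply: (iffP existsP) => [[y /andP[xy oxy]]|[y xy oxy]]; exists y => //.
by rewrite xy.
Qed.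

Lemma mul_sym x y : mul u x y = mul u y x.
Proof. by rewrite tpermC. Qed.

(** The even edge (v w) is already the one non-simple edge allowed at [w]. *)
Lemma simple_next v w z : joined u v w -> joined u w z -> z != v ->
  ~~ odd (mul u v w) -> mul u w z = 1%N.
Proof.
move=> vw wz nzv evw; have := mul_gt0 wz; rewrite leq_eqVlt => /orP[/eqP//|wz2].
have vw2 := even_gt1 (mul_gt0 vw) evw; rewrite joined_sym in vw; rewrite mul_sym in vw2.
by rewrite (nonsimple_u wz vw wz2 vw2) eqxx in nzv.
Qed.

(** Such an [x] is the leaf of an even twig: the non-leaf vertex also lies on a simple, hence odd,
    edge. *)
Lemma off_support x y : joined u x y -> x \notin odd_support ->
  y \in odd_support /\ forall z, joined u x z -> z = y.
Proof.
move=> xy xS; have exy : ~~ odd (mul u x y).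
  by apply: contra xS => oxy; apply/odd_supportP; exists y.
have [v [w [z [[[vx wy]|[vy wx]] lv nzv wz nw]]]] := even_u xy exy; subst v w.
  split=> //; apply/odd_supportP; exists z => //.
  by rewrite (simple_next xy wz nzv exy).
case/negP: xS; apply/odd_supportP; exists z => //.
rewrite joined_sym in xy; rewrite mul_sym in exy.
by rewrite (simple_next xy wz nzv exy).
Qed.

Definition odd_letter : pred {perm T} := fun f => odd (count_mem f u).

(** Paths are retracted onto the odd support by sending each leaf off the support to its only
    neighbor. *)
Lemma connect_odd_support r x y : perm_eq r u ->
    x \in odd_support -> y \in odd_support ->
  connect (joined (filter odd_letter r)) x y.
Proof.
move=> ru xS yS; set r1 := filter _ r.
pose phi z := if z \in odd_support then z else odflt z [pick y | joined u z y].
have phiE z a : z \notin odd_support -> joined u z a -> phi z = a.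
  move=> zS za; rewrite /phi (negPf zS).
  case: pickP => [b zb|/(_ a)]; last by rewrite za.
  by have [_] := off_support za zS; apply.
have phiS z : z \in odd_support -> phi z = z by rewrite /phi => ->.
have step a b : joined u a b -> connect (joined r1) (phi a) (phi b).
  move=> ab; have [aS|aS] := boolP (a \in odd_support); last first.
    by have [bS _] := off_support ab aS; rewrite (phiE a b) // phiS.
  have [bS|bS] := boolP (b \in odd_support); last first.
    by rewrite joined_sym in ab; rewrite (phiE b a) // phiS.
  rewrite !phiS //; case oab: (odd (mul u a b)).
    apply: connect1; case/andP: ab => nab abu; rewrite /joined nab mem_filter /=.
    by rewrite /odd_letter oab (perm_mem ru).
  (* An even edge cannot have both ends in the support: its leaf lies on no other edge. *)
  have [v [w [z [vw lv _ _ _]]]] := even_u ab (negbT oab).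
  have vS : v \in odd_support by case: vw => -[-> _].
  have [y' vy' ov] := odd_supportP _ vS.
  move: ov; rewrite (lv _ vy'); case: vw => -[-> ->]; rewrite ?oab //.
  by rewrite mul_sym oab.
rewrite -(phiS x xS) -(phiS y yS); case/connectP: (connected_u x y) => p.
elim: p x {xS} => [|a p IH] x /=; first by move=> _ ->.
by case/andP=> xa ap yl; apply: connect_trans (step _ _ xa) (IH a ap yl).
Qed.

Lemma prod_fix r z : (forall f, f \in r -> f z = z) -> (\prod_(f <- r) f) z = z.
Proof.
elim: r => [|f r IH] H; first by rewrite big_nil perm1.
rewrite big_cons permM H ?mem_head // IH // => h hr.
by apply: H; rewrite inE hr orbT.
Qed.

Lemma disjoint_commute a b c d : a != c -> a != d -> b != c -> b != d ->
  tperm a b * tperm c d = tperm c d * tperm a b.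
Proof. by move=> ac ad bc bd; rewrite conjgC tpermJ !tpermD // eq_sym. Qed.

(** Even letters are deleted one at a time. If [v] is the leaf of (v w) and [z] the other neighbor
    of [w], all other letters but (w z) commute with (v w), and (w z) occurs once. *)
Lemma conj_remove_all_even r : perm_eq r u ->
  exists s, \prod_(f <- r) f = (\prod_(f <- filter odd_letter r) f) ^ s.
Proof.
move=> ru; pose E := [seq f <- undup u | ~~ odd_letter f].
suff [s ->] : exists s, \prod_(f <- r) f =
    (\prod_(f <- [seq f <- r | f \notin E]) f) ^ s.
  exists s; congr (_ ^ s); congr (\prod_(f <- _) f); apply: eq_in_filter => f fr.
  by rewrite mem_filter mem_undup -(perm_mem ru) fr andbT negbK.
have : uniq E by rewrite filter_uniq ?undup_uniq.
have : {subset E <= [pred f | (f \in u) && ~~ odd_letter f]}.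
  by move=> f; rewrite mem_filter mem_undup inE andbC.
elim: E => [|e E IH] sE /=; first by exists 1; rewrite conjg1 filter_predT.
case/andP=> eE uE; have [|s ->] := IH _ uE.
  by move=> f fE; apply: sE; rewrite inE fE orbT.
set r' := filter _ r.
have /andP[eu ee] := sE e (mem_head _ _).
have [x [y [nxy Ee]]] := tu eu.
have xy : joined u x y by rewrite /joined nxy -Ee.
have exy : ~~ odd (mul u x y) by rewrite -Ee.
have [v [w [z [vw lv nzv wz nw]]]] := even_u xy exy.
have jvw : joined u v w by case: vw => -[-> ->]; rewrite // joined_sym.
have Evw : e = tperm v w by rewrite Ee; case: vw => -[-> ->]; rewrite // tpermC.
have nvw : v != w by case/andP: jvw.
have evw : ~~ odd (mul u v w) by rewrite -Evw.
have r'u f : f \in r' -> f \in u by rewrite mem_filter (perm_mem ru) => /andP[].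
have ler f : count_mem f r' <= count_mem f u.
  by rewrite -(seq.permP ru); rewrite count_filter; apply: sub_count => h /andP[].
have er' : count_mem e r' = count_mem e u.
  rewrite count_filter -(seq.permP ru); apply: eq_count => f /=.
  by case: eqVneq => //= ->; rewrite eE.
have ee1 : e * e = 1 by rewrite Ee tperm2.
have mwz := simple_next jvw wz nzv evw.
have [||||s' ->] := @conj_remove_even _ e (tperm w z) r' ee1.
- by rewrite er'.
- by rewrite -mwz ler.
- by rewrite Evw [tperm v w]tpermC -[tperm w v]tpermC tpermC tperm_neq // 1?eq_sym //;
    case/andP: wz.
(* The remaining letters move neither [v] nor [w]. *)
- move=> f /r'u fu nfz nfe; have [a [b [nab Ef]]] := tu fu.
  have ab : joined u a b by rewrite /joined nab -Ef.
  have off p q : joined u p q -> tperm p q != tperm w z -> tperm p q != e ->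
      p != v /\ p != w.
    move=> pq nz ne; split; apply/eqP => pE; move: pq nz ne; rewrite pE.
      by move=> /lv ->; rewrite Evw eqxx.
    by move=> /nw[] ->; rewrite ?eqxx // Evw tpermC eqxx.
  rewrite Ef in nfz nfe; have [av aw] := off _ _ ab nfz nfe.
  rewrite joined_sym in ab; rewrite tpermC in nfz nfe.
  have [bv bw] := off _ _ ab nfz nfe.
  by rewrite Ef Evw disjoint_commute.
exists (s' * s); rewrite -conjgM; congr (_ ^ _).
congr (\prod_(f <- _) f); rewrite -filter_predI; apply: eq_filter => f.
by rewrite /= inE negb_or.
Qed.

(** After the multiple letters are pushed aside, the number of letters equals the number of distinct
    odd edges, which form a forest, and the connections are kept. Hence every letter merges two
    cycles, and the product is transitive on the connected odd support. *)
Lemma cycle_on_odd_support r : perm_eq r u ->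
  cycle_on odd_support (\prod_(f <- filter odd_letter r) f).
Proof.
move=> ru; have conn := connect_odd_support ru; set r1 := filter _ r in conn *.
have mr1 f : (f \in r1) = (f \in u) && odd_letter f.
  by rewrite mem_filter (perm_mem ru) andbC.
have r1u : {subset r1 <= u} by move=> f; rewrite mr1 => /andP[].
have tr1 : transpositions r1 by apply: transpositions_sub tu.
have cr1 f : f \in r1 -> count_mem f r1 = count_mem f u.
  rewrite mr1 => /andP[_ of1]; rewrite count_filter -(seq.permP ru).
  by apply: eq_count => h /=; case: eqVneq => //= ->.
have sup f : f \in r1 -> exists a b, [/\ joined u a b, f = tperm a b,
    a \in odd_support & b \in odd_support].
  rewrite mr1 => /andP[fu of1]; have [a [b [nab Ef]]] := tu fu.
  have ab : joined u a b by rewrite /joined nab -Ef.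
  rewrite /odd_letter Ef in of1; exists a, b; split=> //; apply/odd_supportP.
    by exists b.
  by exists a; rewrite 1?joined_sym // mul_sym.
split=> [z zS|].
  apply: prod_fix => f /sup[a [b [_ -> aS bS]]].
  by rewrite tpermD //; [apply: contraNneq zS => <-|apply: contraNneq zS => <-].
pose M f := 1 < count_mem f u.
have shared a b c : joined u a b -> joined u a c -> M (tperm a b) ->
  M (tperm a c) -> b = c by apply: nonsimple_u.
(* Distinct non-simple edges share no vertex. *)
have cM f h : f \in r1 -> h \in r1 -> M f -> M h -> f * h = h * f.
  move=> /sup[a [b [ab -> _ _]]] /sup[c [d [cd -> _ _]]] Mf Mh.
  have [->//|nfh] := eqVneq (tperm a b) (tperm c d).
  have off p q p' q' : joined u p q -> joined u p' q' -> M (tperm p q) ->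
      M (tperm p' q') -> tperm p q != tperm p' q' -> p != p'.
    move=> pq p'q' M1 M2; apply: contraNneq => E; rewrite E in pq M1 *.
    by rewrite (shared _ _ _ pq p'q' M1 M2).
  have [ba dc] : joined u b a /\ joined u d c by split; rewrite joined_sym.
  have Mt p q : M (tperm p q) -> M (tperm q p) by rewrite tpermC.
  apply: disjoint_commute.
  - exact: off ab cd Mf Mh nfh.
  - by apply: off ab dc Mf (Mt _ _ Mh) _; rewrite (tpermC d).
  - by apply: off ba cd (Mt _ _ Mf) Mh _; rewrite (tpermC b).
  - by apply: off ba dc (Mt _ _ Mf) (Mt _ _ Mh) _; rewrite (tpermC b) (tpermC d).
have [w [F [Er sw [uF mF] tw Lw]]] := push_commuting tr1 cM.
have mF1 f : (f \in F) = (f \in r1) && M f.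
  rewrite mF; case fr1: (f \in r1) => //=; rewrite cr1 //.
  by move: fr1; rewrite mr1 /odd_letter => /andP[_ ->]; rewrite andbT.
(* The letters outside [M] are simple, so they occur once. *)
have uN : uniq (filter (predC M) r1).
  apply: count_mem_uniq => f; have := mem_filter (predC M) f r1.
  have [fr1|fr1] := boolP (f \in r1); last first.
    by rewrite andbF => E; rewrite E; apply/count_memPn; rewrite E.
  rewrite andbT => mf; rewrite mf /= /M -leqNgt; case: leqP => [le1|gt1].
    apply/eqP; rewrite eqn_leq count_filter; apply/andP; split.
      apply: leq_trans le1; rewrite -(cr1 f fr1).
      by apply: sub_count => h /andP[].
    rewrite -has_count; apply/hasP; exists f; rewrite //= eqxx /= /M -leqNgt.
    exact: leq_trans le1.
  by apply/count_memPn; rewrite mf /= /M gt1.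
have perm1 : perm_eq (filter (predC M) r1 ++ F) (undup r1).
  apply: uniq_perm; rewrite ?undup_uniq //.
    rewrite cat_uniq uN uF andbT; apply/hasPn => f; rewrite mF1 => /andP[_ Mf].
    by apply/negP; rewrite mem_filter /= => /andP[/negP].
  move=> f; rewrite mem_cat mem_undup mem_filter mF1 /=.
  by case: (f \in r1); rewrite ?andbF //= andbT orNb.
have size_wF : size (w ++ F) = size (undup r1).
  by rewrite size_cat sw -size_filter -size_cat (perm_size perm1).
have sub1 : {subset F <= r1} by move=> f; rewrite mF1 => /andP[].
have twF : transpositions (w ++ F).
  by move=> f; rewrite mem_cat => /orP[/tw|/sub1/tr1].
have tu1 : transpositions (undup r1) by move=> f; rewrite mem_undup => /tr1.
have Fu1 : forest (undup r1).
  move=> c c3 /andP[cc uc]; apply: (Fu (c := c)) => //; rewrite /ucycle uc andbT.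
  case: c cc {uc c3} => //= p c; apply: sub_path; apply: joined_sub => f.
  by rewrite mem_undup => /r1u.
have [lab [L1 L2 L3 _ _]] := component_labels twF.
have [lab0 [_ _ _ K4 K5]] := component_labels tu1.
have {}K5 := K5 (undup_uniq _) Fu1.
have lab_r1 f z : f \in r1 -> lab (f z) = lab z.
  apply: Lw => g y gr; first by apply: L1; rewrite mem_cat gr.
  by move=> Mg; apply: L1; rewrite mem_cat mF1 gr Mg orbT.
have lab_conn x y : connect (joined r1) x y -> lab x = lab y.
  case/connectP=> p; elim: p x => [|s p IH] x /=; first by move=> _ ->.
  case/andP=> /andP[_ xs] sp /(IH s sp) <-.
  by rewrite -(lab_r1 _ x xs) tpermL.
(* [lab] is constant on the components that [lab0] labels, so it has no more values than [lab0],
   whose count is exact for a forest. *)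
have E : #|T| = (#|lab @: T| + size (w ++ F))%N.
  apply/eqP; rewrite eqn_leq L2 /= [X in _ <= X]K5 size_wF leq_add2r.
  have -> : lab @: T = lab @: (lab0 @: T).
    apply/setP=> l; apply/imsetP/imsetP => [[z _ ->]|[z _ ->]]; last by exists z.
    exists (lab0 z); first exact: imset_f.
    apply: lab_conn; apply: connect_sub_joined (K4 z) => f.
    by rewrite mem_undup.
  exact: leq_imset_card.
move=> y z yS zS; rewrite Er -big_cat; apply: L3 => //.
exact/lab_conn/conn.
Qed.

Lemma forest_product_conj r1 r2 : perm_eq r1 u -> perm_eq r2 u ->
  exists s, \prod_(f <- r1) f = (\prod_(f <- r2) f) ^ s.
Proof.
move=> r1u r2u; have [s1 ->] := conj_remove_all_even r1u.
have [s2 ->] := conj_remove_all_even r2u.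
have [s ->] := cycle_on_conj (cycle_on_odd_support r2u) (cycle_on_odd_support r1u).
by exists (s2^-1 * (s * s1)); rewrite -!conjgM mulKVg.
Qed.

End Sufficiency.

(** * Conditions forced on a tree by uniform energy *)

Section Necessity.
Variable T : finType.
Implicit Types (x y z a b c d : T).
Variable u : seq {perm T}.

Local Notation mul u x y := (count_mem (tperm x y) u).

Hypotheses (Fu : forest u) (tu : transpositions u) (Eu : uniform_energy u).

Lemma forest_no_triangle x y z : joined u x y -> joined u y z -> joined u x z -> False.
Proof.
move=> xy yz xz; apply: (Fu (c := [:: x; y; z])) => //.
rewrite /ucycle /= xy yz joined_sym xz /= !inE negb_or andbT.
by case/andP: xy => ->; case/andP: yz => ->; case/andP: xz => ->.
Qed.

Lemma even_neighbor_odd x y a : joined u x y -> ~~ odd (mul u x y) ->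
  joined u x a -> a != y -> odd (mul u x a).
Proof.
move=> xy exy xa nay; apply/negPn/negP => exa.
rewrite joined_sym in xy; rewrite mul_sym in exy; rewrite eq_sym in nay.
apply: (forest_adjacent_contra Fu tu Eu xy xa nay).
- exact: even_gt1 (mul_gt0 xy) exy.
- exact: even_gt1 (mul_gt0 xa) exa.
- by rewrite (negPf exy) (negPf exa).
Qed.

(** A third neighbor of [x] would give a forbidden star, a second neighbor of [y] a forbidden path
    with the even edge in the middle. *)
Lemma even_edge_neighbors x y a : joined u x y -> ~~ odd (mul u x y) ->
    joined u x a -> a != y ->
  (forall b, joined u x b -> b = y \/ b = a) /\ (forall b, joined u y b -> b = x).
Proof.
move=> xy exy xa nay; have oa := even_neighbor_odd xy exy xa nay.
have nxy : x != y by case/andP: xy.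
have nxa : x != a by case/andP: xa.
split=> b bj.
  have [|nby] := eqVneq b y; first by left.
  have [|nba] := eqVneq b a; [by right | exfalso].
  have ob := even_neighbor_odd xy exy bj nby; have nxb : x != b by case/andP: bj.
  have U : uniq [:: x; y; a; b].
    by rewrite /= !inE !negb_or nxy nxa nxb ![y == _]eq_sym nay nby eq_sym nba.
  exact: (forest_star_contra Fu tu Eu U xy xa bj exy oa ob).
apply/eqP/negPn/negP => nbx; have nyb : y != b by case/andP: bj.
have yx : joined u y x by rewrite joined_sym.
have ax : joined u a x by rewrite joined_sym.
have ob : odd (mul u y b) by apply: even_neighbor_odd yx _ bj nbx; rewrite mul_sym.
have nab : a != b.
  by apply/eqP => ab; rewrite -ab in bj; apply: forest_no_triangle xy bj xa.
have U : uniq [:: a; x; y; b].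
  by rewrite /= !inE !negb_or nxy nyb nab nay [a == x]eq_sym nxa [x == b]eq_sym nbx.
apply: (forest_path_contra Fu tu Eu U ax xy bj); left; split=> //.
by rewrite mul_sym.
Qed.

Hypothesis connected_u : forall x y, connect (joined u) x y.

(** By connectedness and a third vertex some edge leaves {x, y}; the end it leaves from is the
    non-leaf vertex. *)
Lemma even_edge_twig x y : 2 < #|T| -> joined u x y -> ~~ odd (mul u x y) ->
  exists v w, [/\ (v, w) = (x, y) \/ (v, w) = (y, x),
    joined u v w, #|[set z | joined u v z]| = 1%N & #|[set z | joined u w z]| = 2].
Proof.
move=> T3; have main v w z : joined u w v -> ~~ odd (mul u w v) -> joined u w z ->
    z != v -> [/\ joined u v w, #|[set z | joined u v z]| = 1%N &
      #|[set z | joined u w z]| = 2].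
  move=> wv ewv wz nzv; have [Nw Nv] := even_edge_neighbors wv ewv wz nzv.
  have vw : joined u v w by rewrite joined_sym.
  split=> //.
    rewrite (_ : finset _ = [set w]) ?cards1 //; apply/setP=> b; rewrite !inE.
    by apply/idP/eqP => [/Nv|->].
  rewrite (_ : finset _ = [set v; z]) ?cards2 1?eq_sym ?nzv //.
  apply/setP=> b; rewrite !inE; apply/idP/orP => [/Nw[]->|[]/eqP->//].
    by left.
  by right.
move=> xy exy.
have [|w wA] := @exists_notin T [set x; y].
  by apply: leq_ltn_trans T3; rewrite cards2; case: eqP.
have [s [q [sA qA sq]]] := connect_exit (connected_u x w) (set21 x y) wA.
move: qA; rewrite !inE negb_or => /andP[qx qy].
case/set2P: sA sq => -> sq.
  by have [] := main y x q xy exy sq qy; exists y, x; split=> //; right.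
rewrite joined_sym in xy; rewrite mul_sym in exy.
by have [] := main x y q xy exy sq qx; exists x, y; split=> //; left.
Qed.

(** Equal parities are excluded, so let (x y) be even and (x z) odd. Then [x] and [y] have no
    further neighbors, a fourth vertex [q] hangs on [z], and the path y - x - z - q is forbidden. *)
Lemma nonsimple_edges_eq x y z : 3 < #|T| -> joined u x y -> joined u x z ->
  1 < mul u x y -> 1 < mul u x z -> y = z.
Proof.
move=> T4; wlog exy : y z / ~~ odd (mul u x y).
  move=> W xy xz xy2 xz2; have [oy|oy] := boolP (odd (mul u x y)); last exact: W.
  have [oz|oz] := boolP (odd (mul u x z)); last by apply/esym/W.
  apply/eqP/negPn/negP => nyz; rewrite joined_sym in xy; rewrite mul_sym in oy xy2.
  by apply: (forest_adjacent_contra Fu tu Eu xy xz nyz xy2 xz2); rewrite oy oz.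
move=> xy xz xy2 xz2; apply/eqP/negPn/negP => nyz.
rewrite eq_sym in nyz; have [Nx Ny] := even_edge_neighbors xy exy xz nyz.
have oz := even_neighbor_odd xy exy xz nyz.
have nxy : x != y by case/andP: xy.
have nxz : x != z by case/andP: xz.
have [w wA] := exists_notin (leq_ltn_trans (cards3_le x y z) T4).
have xA : x \in [set x; y; z] by rewrite !inE eqxx.
have [s [q [sA qA sq]]] := connect_exit (connected_u x w) xA wA.
move: qA; rewrite !inE !negb_or -andbA => /and3P[qx qy qz].
move: sA; rewrite !inE -orbA => /or3P[] /eqP sE; rewrite sE in sq.
- by case: (Nx q sq) => E; rewrite E eqxx in qy qz.
- by rewrite (Ny q sq) eqxx in qx.
have yx : joined u y x by rewrite joined_sym.
have U : uniq [:: y; x; z; q].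
  by rewrite /= !inE !negb_or [y == x]eq_sym nxy [y == z]eq_sym nyz nxz
    ![_ == q]eq_sym qx qy qz.
apply: (forest_path_contra Fu tu Eu U yx xz sq); right; split=> //.
by rewrite mul_sym.
Qed.

End Necessity.

(** * Two and three vertices *)

Section ThreePoints.
Variable T : finType.
Implicit Types (x y z a b c d : T) (g h : {perm T}).

Lemma perm_pair h y z : (forall x, x != y -> x != z -> h x = x) ->
  h = 1 \/ h = tperm y z.
Proof.
move=> H; have st x : x = y \/ x = z -> h x = y \/ h x = z.
  move=> xyz; have [|ny] := eqVneq (h x) y; first by left.
  have [|nz] := eqVneq (h x) z; first by right.
  have /perm_inj E := H _ ny nz.
  by case: xyz => xE; rewrite E xE eqxx in ny nz.
case: (st y (or_introl erefl)) => hy.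
  left; apply/permP=> x; rewrite perm1; have [->//|ny] := eqVneq x y.
  have [->|nz] := eqVneq x z; last exact: H.
  case: (st z (or_intror erefl)) => // hz.
  by rewrite hz; apply: (@perm_inj _ h); rewrite hy hz.
right; apply/permP=> x; case: tpermP => [->//|->|/eqP ny /eqP nz]; last exact: H.
case: (st z (or_intror erefl)) => // hz.
by rewrite hz; apply: (@perm_inj _ h); rewrite hz hy.
Qed.

Lemma tperm_conj a b c d : a != b -> c != d -> exists s, tperm a b = tperm c d ^ s.
Proof.
move=> nab ncd; pose b' := tperm c a d.
have nab' : b' != a by rewrite -[X in _ != X](tpermL c a) (inj_eq perm_inj) eq_sym.
(* The first factor takes [c] to [a] and [d] to [b']; the second takes [b'] to [b] and fixes [a]. *)
exists (tperm c a * tperm b' b).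
by rewrite conjgM !tpermJ tpermL -/b' tpermL tpermD // eq_sym.
Qed.

Lemma odd_prod_transpositions (r : seq {perm T}) : transpositions r ->
  odd_perm (\prod_(f <- r) f) = odd (size r).
Proof.
elim: r => [|t r IH] tr; first by rewrite big_nil odd_perm1.
have [a [b [nab Et]]] := tr t (mem_head _ _).
rewrite big_cons Et odd_mul_tperm nab IH //.
by apply: transpositions_sub tr => f fr; rewrite inE fr orbT.
Qed.

Lemma card3_cover a b c : #|T| = 3 -> uniq [:: a; b; c] ->
  forall x, x \in [:: a; b; c].
Proof.
move=> T3 U x; have sub : {subset [:: a; b; c] <= enum T} by move=> y; rewrite mem_enum.
have sz : size (enum T) <= size [:: a; b; c] by rewrite -cardE T3.
by have [_ ->] := uniq_min_size U sub sz; rewrite mem_enum.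
Qed.

(** If [g] moves [x], then [g * tperm x (g x)] is even and fixes [x], so on three points it is the
    identity. *)
Lemma odd_perm_card3 g : #|T| = 3 -> odd_perm g -> exists a b, a != b /\ g = tperm a b.
Proof.
move=> T3 og; have [x nx] : exists x, g x != x.
  apply/existsP; apply: contraLR og => nex; have -> : g = 1.
    apply/permP=> x; rewrite perm1; apply/eqP; apply: contraR nex => nx.
    by apply/existsP; exists x.
  by rewrite odd_perm1.
pose h := g * tperm x (g x).
have hx : h x = x by rewrite permM tpermR.
have eh : odd_perm h = false by rewrite odd_permM og odd_tperm eq_sym nx.
have Eg : g = h * tperm x (g x) by rewrite -mulgA tperm2 mulg1.
suff h1 : h = 1 by exists x, (g x); rewrite eq_sym; split; rewrite // {1}Eg h1 mul1g.
have [|z] := @exists_notin T [set x; g x].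
  by rewrite T3 cards2; case: eqP.
rewrite !inE negb_or => /andP[nzx nzg].
have U : uniq [:: x; g x; z].
  by rewrite /= !inE !negb_or ![_ == z]eq_sym ![x == _]eq_sym nx nzx nzg.
have [//|E] : h = 1 \/ h = tperm (g x) z.
  apply: perm_pair => y ny1 ny2; have := card3_cover T3 U y.
  by rewrite !inE (negPf ny1) (negPf ny2) !orbF => /eqP->.
by rewrite E odd_tperm eq_sym nzg in eh.
Qed.

End ThreePoints.

Section TwigConditions.
Variables (T : finType) (u : seq {perm T}).

Local Notation mul x y := (count_mem (tperm x y) u).

Hypotheses (Fu : forest u) (tu : transpositions u).
Hypothesis connected_u : forall x y, connect (joined u) x y.
Hypothesis nonsimple_u : forall x y z, joined u x y -> joined u x z ->
  1 < mul x y -> 1 < mul x z -> y = z.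
Hypothesis twig_u : forall x y, joined u x y -> ~~ odd (mul x y) ->
  exists v w, [/\ (v, w) = (x, y) \/ (v, w) = (y, x), joined u v w,
    #|[set z | joined u v z]| = 1%N & #|[set z | joined u w z]| = 2].

Lemma twig_product_conj r1 r2 : perm_eq r1 u -> perm_eq r2 u ->
  exists s, \prod_(f <- r1) f = (\prod_(f <- r2) f) ^ s.
Proof.
apply: forest_product_conj => // x y xy exy.
have [v [w [vw jvw c1 c2]]] := twig_u xy exy.
have /eqP/cards1P[w' Ev] := c1; have /eqP/cards2P[a [b [nab Ew]]] := c2.
have wv : joined u w v by rewrite joined_sym.
have vab : v \in [set a; b] by rewrite -Ew inE.
have [z [nzv Ez]] : exists z, z != v /\ [set a; b] = [set v; z].
  case/set2P: vab => ->; first by exists b; rewrite eq_sym.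
  by exists a; rewrite setUC.
rewrite {}Ez in Ew; exists v, w, z; split=> // [z' vz'||z' wz'].
- have : z' \in [set w'] by rewrite -Ev inE.
  have : w \in [set w'] by rewrite -Ev inE.
  by move=> /set1P-> /set1P.
- by have : z \in [set v; z] := set22 v z; rewrite -Ew inE.
- by apply/set2P; rewrite -Ew inE.
Qed.

End TwigConditions.

Section ThreeVertices.
Variables (T : finType) (u : seq {perm T}).
Implicit Types (x y z a b c p : T).
Hypothesis T3 : #|T| = 3.

Local Notation mul x y := (count_mem (tperm x y) u).

Hypotheses (tu : transpositions u).
Hypothesis connected_u : forall x y, connect (joined u) x y.

(** For [j], [k] odd, multiplicities 2, 1, 1 remain, and (a b)(b c)(a b)(a c) = 1 while (a b)(a b)(b
    c)(a c) is a 3-cycle. For [j], [k] even, the third edge is dropped and two adjacent even edges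
    remain. *)
Lemma triangle_letters_contra a b c i j k : uniq [:: a; b; c] ->
    ~~ odd i -> 0 < i -> 0 < j -> 0 < k -> ~~ odd (j + k) ->
  ~ uniform_energy (nseq i (tperm a b) ++ nseq j (tperm b c) ++ nseq k (tperm a c)).
Proof.
move=> U ei i0 j0 k0 ejk; have := U; rewrite /= !inE !negb_or andbT -andbA.
case/and3P=> nab nac nbc E.
have p1 x y : (y \in porbit (1 : {perm T}) x) = (y == x).
  by rewrite porbit_fix ?perm1 // inE.
have i2 := even_gt1 i0 ei; rewrite -[X in uniform_energy X]cats0 -!catA in E.
have {}E := @uniform_energy_nseq _ a b i 2 _ i2 (negbTE ei) E.
have [oj|ej] := boolP (odd j).
  have ok : odd k by move: ejk; rewrite oddD oj; case: (odd k).
  have {}E := @uniform_energy_nseq_mid _ b c j 1 _ _ j0 oj E.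
  rewrite catA in E; have {}E := @uniform_energy_nseq_mid _ a c k 1 _ _ k0 ok E.
  have [q H] := E; rewrite /= in H.
  have E2 := H [:: tperm a b; tperm a b; tperm b c; tperm a c] (perm_refl _).
  have := H [:: tperm a b; tperm b c; tperm a b; tperm a c].
  rewrite -E2 !big_cons big_nil !mulg1 (mulgA (tperm a b) (tperm a b)).
  have -> : tperm a b * (tperm b c * (tperm a b * tperm a c)) = 1.
    rewrite !mulgA -(mulgA (tperm a b)) -{1}(tpermV a b) -conjgE tpermJ.
    by rewrite tpermR tpermD // tperm2.
  rewrite tperm2 mul1g -[tperm a c in X in _ -> _ = X]mulg1 => E1.
  have ca : c \notin porbit (1 : {perm T}) a by rewrite p1 eq_sym.
  have cb : c \notin porbit (tperm a c * 1) b.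
    rewrite porbit_sym porbit_merge // !inE !p1 eqxx orbT.
    by rewrite in_setU !p1 negb_or ![b == _]eq_sym nab eq_sym nbc.
  have := ltn_trans (cycle_energy_merge_gt ca) (cycle_energy_merge_gt cb).
  by rewrite E1 ?ltnn //; apply/seq.permP => p /=; lia.
have ek : ~~ odd k by move: ejk; rewrite oddD (negPf ej).
have j2 := even_gt1 j0 ej.
rewrite catA in E.
have {}E := @uniform_energy_nseq_mid _ a c k 0 _ _ (leq0n k) (negbTE ek) E.
rewrite /= cats0 in E; rewrite -[nseq j _]cats0 in E.
apply: (adjacent_letters_contra (v := [::]) _ _ _ (ltnSn 1) j2 _ E).
- by rewrite big_nil p1 eq_sym.
- by rewrite big_nil p1 eq_sym.
- by rewrite big_nil p1 eq_sym.
- by rewrite (negPf ej).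
Qed.

(** With an even total, one of the three multiplicities is even and the other two have an even sum;
    the triangle is rotated so that the even edge comes first. *)
Lemma even_letters_no_triangle x y z : uniform_energy u -> ~~ odd (size u) ->
  joined u x y -> joined u y z -> joined u x z -> False.
Proof.
move=> Eu eu xy yz xz.
have nxy : x != y by case/andP: xy.
have nyz : y != z by case/andP: yz.
have nxz : x != z by case/andP: xz.
have U : uniq [:: x; y; z] by rewrite /= !inE !negb_or nxy nyz nxz.
pose E := [:: tperm x y; tperm y z; tperm x z].
have uE : uniq E.
  have n2 : tperm x y != tperm x z by rewrite tpermC tperm_neq // eq_sym.
  have n3 : tperm y z != tperm x z by rewrite tperm_neq // eq_sym.
  by rewrite /= !inE !negb_or n2 n3 tperm_neq.
have pu : perm_eq u (nseq (mul x y) (tperm x y) ++ nseq (mul y z) (tperm y z) ++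
    nseq (mul x z) (tperm x z)).
  have := extract_letters u uE; rewrite /= cats0.
  rewrite (_ : [seq f <- u | f \notin E] = [::]) ?cats0 //.
  apply/eqP; rewrite -[_ == _]negbK -has_filter; apply/hasPn => f /tu[a [b [nab ->]]].
  rewrite negbK !inE; have cov w : [|| w == x, w == y | w == z].
    by have := card3_cover T3 U w; rewrite !inE.
  move: nab; case/or3P: (cov a) => /eqP->; case/or3P: (cov b) => /eqP->;
    by rewrite ?eqxx ?orbT //= tpermC ?eqxx ?orbT.
have := mul_gt0 xy; have := mul_gt0 yz; have := mul_gt0 xz.
have {}Eu := uniform_energy_perm pu Eu.
move: eu; rewrite (perm_size pu) !size_cat !size_nseq => eu k0 j0 i0.
have [oi|ei] := boolP (odd (mul x y)); last first.
  apply: (triangle_letters_contra U ei i0 j0 k0 _ Eu).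
  by move: eu; rewrite oddD (negPf ei).
have [oj|ej] := boolP (odd (mul y z)).
  have ek : ~~ odd (mul x z) by move: eu; rewrite !oddD oi oj; case: (odd (mul x z)).
  have U' : uniq [:: x; z; y] by rewrite /= !inE !negb_or nxz nxy eq_sym nyz.
  apply: (@triangle_letters_contra x z y _ (mul y z) (mul x y) U' ek k0 j0 i0).
    by rewrite oddD oi oj.
  apply: uniform_energy_perm Eu; rewrite [tperm z y]tpermC.
  by rewrite perm_catC -catA perm_catCA.
have U' : uniq [:: y; z; x] by rewrite /= !inE !negb_or nyz ![_ == x]eq_sym nxy nxz.
apply: (@triangle_letters_contra y z x _ (mul x z) (mul x y) U' ej j0 k0 i0).
  by rewrite addnC; move: eu; rewrite !oddD (negPf ej).
apply: uniform_energy_perm Eu; rewrite [tperm z x]tpermC [tperm y x]tpermC.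
by rewrite perm_catC -catA.
Qed.

Lemma card3_path : exists c p q,
  [/\ uniq [:: c; p; q], joined u c p & joined u c q].
Proof.
have /card_gt0P[x0 _] : 0 < #|T| by rewrite T3.
have [|w wx] := @exists_notin T [set x0]; first by rewrite cards1 T3.
have [a [b [/set1P-> {wx}_ ab]]] := connect_exit (connected_u x0 w) (set11 x0) wx.
have nab : x0 != b by case/andP: ab.
have [|q qA] := @exists_notin T [set x0; b].
  by rewrite T3 cards2; case: eqP.
have [s [r [sA rA sr]]] := connect_exit (connected_u x0 q) (set21 x0 b) qA.
move: rA; rewrite !inE negb_or => /andP[rx rb].
case/set2P: sA sr => -> sr.
  by exists x0, b, r; rewrite /= !inE !negb_or nab ![_ == r]eq_sym rx rb.
exists b, x0, r; split=> //; last by rewrite joined_sym.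
by rewrite /= !inE !negb_or [b == _]eq_sym nab ![_ == r]eq_sym rx rb.
Qed.

Lemma card3_forest c p q : uniq [:: c; p; q] -> joined u c p -> joined u c q ->
  ~~ joined u p q -> forest u.
Proof.
move=> U cp cq npq [|x [|y [|z [|w s]]]] // _; last first.
  case/andP=> _ /card_uniqP /= cs; have := max_card (mem [:: x, y, z, w & s]).
  by rewrite cs T3.
case/andP=> /and4P[xy yz zx _] Uxyz; have cov := card3_cover T3 Uxyz.
case/negP: npq; move: U (cov p) (cov q); rewrite /= !inE !negb_or andbT.
case/andP=> _ npq.
have [yx zy xz] : [/\ joined u y x, joined u z y & joined u x z].
  by split; rewrite joined_sym.
by case/or3P=> /eqP pE /or3P[] /eqP qE; move: npq; rewrite pE qE ?eqxx.
Qed.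

(** The odd permutations of three points are the transpositions, which are all conjugate. *)
Lemma odd_size_conj r1 r2 : odd (size u) -> perm_eq r1 u -> perm_eq r2 u ->
  exists s, \prod_(f <- r1) f = (\prod_(f <- r2) f) ^ s.
Proof.
move=> ou r1u r2u; have tr r : perm_eq r u -> transpositions r.
  by move=> ru f; rewrite (perm_mem ru) => /tu.
have oddr r : perm_eq r u -> odd_perm (\prod_(f <- r) f).
  by move=> ru; rewrite odd_prod_transpositions ?(perm_size ru) //; apply: tr.
have [a [b [nab ->]]] := odd_perm_card3 T3 (oddr r1 r1u).
have [c [d [ncd ->]]] := odd_perm_card3 T3 (oddr r2 r2u).
exact: tperm_conj.
Qed.

(** The tree is a path with a simple edge. Only its other edge can be even, and that edge is a twig
    whose non-leaf vertex has two neighbors, so the general sufficiency argument applies. *)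
Lemma card3_tree_conj r1 r2 x y : forest u -> joined u x y -> mul x y = 1%N ->
    perm_eq r1 u -> perm_eq r2 u ->
  exists s, \prod_(f <- r1) f = (\prod_(f <- r2) f) ^ s.
Proof.
(* Makes [x] the middle vertex of the path. *)
move=> Fu; wlog [z [U xz]] : x y / exists z, uniq [:: x; y; z] /\ joined u x z.
  move=> W xy xy1; have [c [p [q [U cp cq]]]] := card3_path.
  have cov w : [|| w == c, w == p | w == q].
    by have := card3_cover T3 U w; rewrite !inE.
  have npq : ~~ joined u p q.
    by apply/negP => pq; apply: (forest_no_triangle Fu) cp pq cq.
  have nqp : ~~ joined u q p by rewrite joined_sym.
  have U' : uniq [:: c; q; p].
    have := U; rewrite /= !inE !negb_or andbT => /andP[/andP[cp' cq'] pq'].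
    by rewrite cp' cq' eq_sym pq'.
  have yx : joined u y x by rewrite joined_sym.
  have yx1 : mul y x = 1%N by rewrite mul_sym.
  case/or3P: (cov x) => /eqP xE; case/or3P: (cov y) => /eqP yE; subst x y.
  all: try by case/andP: xy => /eqP.
  - by apply: (W c p) => //; exists q.
  - by apply: (W c q) => //; exists p.
  - by apply: (W c p) => //; exists q.
  - by rewrite xy in npq.
  - by apply: (W c q) => //; exists p.
  - by rewrite xy in nqp.
move=> xy xy1.
have cov w : [|| w == x, w == y | w == z].
  by have := card3_cover T3 U w; rewrite !inE.
have nyz : ~~ joined u y z.
  by apply/negP => yz; apply: (forest_no_triangle Fu) xy yz xz.
have nzy : ~~ joined u z y by rewrite joined_sym.
have irr w : ~~ joined u w w by rewrite /joined eqxx.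
have yx1 : mul y x = 1%N by rewrite mul_sym.
have ns v w : joined u v w -> 1 < mul v w -> (v, w) = (x, z) \/ (v, w) = (z, x).
  case/or3P: (cov v) => /eqP->; case/or3P: (cov w) => /eqP->;
    rewrite ?xy1 ?yx1 ?(negPf (irr _)) ?(negPf nyz) ?(negPf nzy) //; by [left|right].
have zx : joined u z x by rewrite joined_sym.
have nzx : z != x by case/andP: zx.
have nzy' : y != z by case/and3P: U => _; rewrite inE.
apply: twig_product_conj => // [v a b va vb va2 vb2|v w vw evw].
  case: (ns _ _ va va2) => -[vE ->]; case: (ns _ _ vb vb2) => -[E ->] //.
    by rewrite -E vE eqxx in nzx.
  by rewrite -vE E eqxx in nzx.
have Nz : [set w | joined u z w] = [set x].
  apply/setP=> t; rewrite !inE; case/or3P: (cov t) => /eqP->.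
  - by rewrite zx eqxx.
  - by rewrite (negPf nzy); case: eqP (irr x) xy => // -> /negP.
  - by rewrite (negPf (irr z)) (negPf nzx).
have Nx : [set w | joined u x w] = [set y; z].
  apply/setP=> t; rewrite !inE; case/or3P: (cov t) => /eqP->.
  - rewrite (negPf (irr x)) [x == z]eq_sym (negPf nzx) orbF.
    by case: eqP xy (irr x) => // <- ->.
  - by rewrite xy eqxx.
  - by rewrite xz eqxx orbT.
exists z, x; rewrite Nz Nx cards1 cards2 nzy'; split=> //.
by case: (ns _ _ vw (even_gt1 (mul_gt0 vw) evw)) => -[-> ->]; [right|left].
Qed.

End ThreeVertices.

(** * Translation between multigraphs and letters *)

Section Bridge.
Variables (n : nat) (u : seq 'S_n).

Lemma mult_tgraph (x y : 'I_n) : x != y ->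
  mult (tgraph u) x y = count_mem (tperm x y) u.
Proof. by rewrite /= /tmult => /negPf->. Qed.

Lemma neighbor_joined : neighbor (tgraph u) =2 joined u.
Proof.
move=> x y; rewrite /neighbor /= /tmult /joined; case: eqP => //= _.
by rewrite -has_count has_pred1.
Qed.

Lemma mult_joined (x y : 'I_n) : joined u x y ->
  mult (tgraph u) x y = count_mem (tperm x y) u.
Proof. by case/andP=> nxy _; apply: mult_tgraph. Qed.

Lemma nonsimple_joined (x y : 'I_n) :
  nonsimple_edge (tgraph u) x y = joined u x y && (1 < count_mem (tperm x y) u).
Proof.
rewrite /nonsimple_edge -neighbor_joined /neighbor; case: (eqVneq x y) => [->|nxy].
  by rewrite mult_irr.
by rewrite mult_tgraph // andbC; case: leqP => //= /ltnW ->.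
Qed.

Lemma neighborsE (x : 'I_n) : neighbors (tgraph u) x = [set y | joined u x y].
Proof. by apply/setP=> y; rewrite !inE neighbor_joined. Qed.

Lemma mg_acyclic_forest : mg_acyclic (tgraph u) <-> forest u.
Proof.
split=> H c c3 uc; apply: (H c c3);
  by rewrite /ucycle (eq_cycle neighbor_joined) in uc *.
Qed.

Lemma mg_connected_joined : mg_connected (tgraph u) ->
  forall x y, connect (joined u) x y.
Proof. by move=> H x y; rewrite -(eq_connect neighbor_joined). Qed.

Lemma ProdP g : reflect (exists2 r, perm_eq r u & g = seq_prod r) (g \in Prod u).
Proof.
rewrite inE; apply: (iffP mapP) => -[r ru ->]; exists r => //.
  by rewrite mem_permutations in ru.
by rewrite mem_permutations.
Qed.

Lemma conjugacy_invariantP : conjugacy_invariant u <->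
  forall r, perm_eq r u -> exists s, seq_prod r = seq_prod u ^ s.
Proof.
split=> [H r ru|H g /ProdP[r ru ->]].
  have /H/imsetP[s _ ->] : seq_prod r \in Prod u by apply/ProdP; exists r.
  by exists s.
by have [s ->] := H r ru; apply: imset_f; rewrite inE.
Qed.

Lemma conjugacy_invariant_energy : conjugacy_invariant u -> uniform_energy u.
Proof.
move/conjugacy_invariantP=> H; exists (cycle_energy (seq_prod u)) => r ru.
by have [s] := H r ru; rewrite /seq_prod => ->; apply: cycle_energyJ.
Qed.

End Bridge.

(** * The cases n = 2, n = 3 and n at least 4 *)

Lemma odd_perm_inj_card2 (T : finType) (g h : {perm T}) : #|T| = 2 ->
  odd_perm g = odd_perm h -> g = h.
Proof.
move=> T2 ogh; apply/eqP; rewrite eq_mulgV1; set k := g * h^-1.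
have ek : odd_perm k = false by rewrite odd_permM odd_permV ogh addbb.
have /eqP/cards2P[x [y [nxy Ty]]] : #|[set: T]| = 2 by rewrite cardsT.
have [->//|E] : k = 1 \/ k = tperm x y.
  apply: perm_pair => z nx ny; have : z \in [set: T] by rewrite inE.
  by rewrite Ty !inE (negPf nx) (negPf ny).
by rewrite E odd_tperm nxy in ek.
Qed.

(** On two points parity determines the permutation, and all rearrangements have the same parity. *)
Lemma two_points n (u : seq 'S_n) : n = 2 -> transpositions u ->
  perm_complete u /\ conjugacy_invariant u.
Proof.
move=> n2 tu; have T2 : #|'I_n| = 2 by rewrite card_ord.
have oddr r : perm_eq r u -> odd_perm (seq_prod r) = odd (size u).
  move=> ru; rewrite odd_prod_transpositions ?(perm_size ru) // => f.
  by rewrite (perm_mem ru) => /tu.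
have PrE g : (g \in Prod u) = (odd_perm g == odd (size u)).
  apply/ProdP/eqP => [[r ru ->]|og]; first exact: oddr.
  by exists u; rewrite // -(oddr u) // in og *; apply: odd_perm_inj_card2 T2 og.
split; last first.
  move=> g; rewrite PrE => /eqP og; apply/imsetP; exists 1; rewrite ?inE // conjg1.
  by apply: (odd_perm_inj_card2 T2); rewrite oddr.
case ou: (odd (size u)); [right|left]; apply/setP=> g; rewrite PrE ou.
  by rewrite in_setD Alt_even inE andbT negbK; case: (odd_perm g).
by rewrite Alt_even; case: (odd_perm g).
Qed.

Lemma three_points n (u : seq 'S_n) : n = 3 -> transpositions u ->
    mg_connected (tgraph u) ->
  (conjugacy_invariant u <->
   odd (size u) \/
   (multitree (tgraph u) /\ exists x y, simple_edge (tgraph u) x y)).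
Proof.
move=> n3 tu hc; have T3 : #|'I_n| = 3 by rewrite card_ord.
have cu := mg_connected_joined hc; split=> [CI|].
  have Eu := conjugacy_invariant_energy CI.
  have [ou|eu] := boolP (odd (size u)); [by left | right].
  have [c [p [q [U cp cq]]]] := card3_path T3 cu.
  have npq : ~~ joined u p q.
    by apply/negP => pq; exact: (even_letters_no_triangle T3 tu Eu eu cp pq cq).
  have Fu := card3_forest T3 U cp cq npq.
  split; first by split; rewrite ?T3 //; apply/mg_acyclic_forest.
  have [cp1|ncp1] := eqVneq (count_mem (tperm c p) u) 1%N.
    by exists c, p; rewrite /simple_edge mult_joined // cp1.
  have [cq1|ncq1] := eqVneq (count_mem (tperm c q) u) 1%N.
    by exists c, q; rewrite /simple_edge mult_joined // cq1.
  have gt2 m : 0 < m -> m != 1%N -> 1 < m by case: m => [|[|m]].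
  have cp2 := gt2 _ (mul_gt0 cp) ncp1; have cq2 := gt2 _ (mul_gt0 cq) ncq1.
  exfalso; move: U; rewrite /= !inE !negb_or andbT => /andP[/andP[ncp ncq] npq'].
  have pc : joined u p c by rewrite joined_sym.
  apply: (forest_adjacent_contra Fu tu Eu pc cq npq').
  - by rewrite tpermC.
  - by [].
  (* Only these two letters occur, so their multiplicities have an even sum and hence equal
     parity. *)
  - pose E := [:: tperm c p; tperm c q].
    have uE : uniq E.
      by rewrite /= inE andbT tpermC tperm_neq // eq_sym.
    have := perm_size (extract_letters u uE).
    rewrite (_ : [seq f <- u | f \notin E] = [::]) /=; last first.
      apply/eqP; rewrite -[_ == _]negbK -has_filter; apply/hasPn => f fu.
      rewrite negbK !inE; have [a [b [nab fE]]] := tu f fu.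
      have cov w : [|| w == c, w == p | w == q].
        have Uc : uniq [:: c; p; q] by rewrite /= !inE !negb_or ncp ncq npq'.
        by have := card3_cover T3 Uc w; rewrite !inE.
      have ab : joined u a b by rewrite /joined nab -fE.
      have nqp : ~~ joined u q p by rewrite joined_sym.
      move: nab ab; rewrite fE.
      by case/or3P: (cov a) => /eqP->; case/or3P: (cov b) => /eqP->;
        rewrite ?eqxx ?orbT ?(negPf npq) ?(negPf nqp) //= tpermC ?eqxx ?orbT.
    rewrite !cats0 size_cat !size_nseq => su; move: eu.
    by rewrite su oddD tpermC; case: odd; case: odd.
move=> H; apply/conjugacy_invariantP => r ru; case: H => [ou|[[_ _ Fu] [x [y xy]]]].
  exact: (odd_size_conj T3 tu ou ru (perm_refl u)).
have jxy : joined u x y by rewrite -neighbor_joined /neighbor (eqP xy).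
apply: (card3_tree_conj T3 tu cu _ jxy _ ru (perm_refl u)).
  exact/mg_acyclic_forest.
by rewrite -mult_joined //; apply/eqP.
Qed.

Theorem theorem3p1 (n : nat) (u : seq 'S_n) (hn : 2 <= n)
    (hu : transpositional u) (hc : mg_connected (tgraph u)) :
  [/\ n = 2 -> perm_complete u /\ conjugacy_invariant u,
      n = 3 ->
        (conjugacy_invariant u <->
         odd (size u) \/
         (multitree (tgraph u) /\ exists x y, simple_edge (tgraph u) x y))
    & 4 <= n ->
        (conjugacy_invariant u <->
         [/\ multitree (tgraph u),
             (forall v, #|[set w | nonsimple_edge (tgraph u) v w]| <= 1)
           & (forall x y, neighbor (tgraph u) x y ->
                ~~ odd (mult (tgraph u) x y) ->
                exists v w, [/\ (v, w) = (x, y) \/ (v, w) = (y, x),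
                                multitwig (tgraph u) v w
                              & #|neighbors (tgraph u) w| = 2])])].
Proof.
have cu := mg_connected_joined hc.
split=> [n2|n3|n4]; [exact: two_points | exact: three_points |].
have T4 : 3 < #|'I_n| by rewrite card_ord.
split=> [CI|[[_ _ /mg_acyclic_forest Fu] ns tw]].
  have Eu := conjugacy_invariant_energy CI.
  have Fu := uniform_energy_forest Eu cu T4.
  split.
  - by split; rewrite ?card_ord ?(ltnW hn) //; apply/mg_acyclic_forest.
  - move=> v; apply/card_le1_eqP => a b; rewrite !inE !nonsimple_joined.
    move=> /andP[va va2] /andP[vb vb2].
    exact: (nonsimple_edges_eq Fu hu Eu cu T4 vb va vb2 va2).
  - move=> x y; rewrite neighbor_joined => xy; rewrite mult_joined // => exy.
    have [v [w [vw jvw c1 c2]]] := even_edge_twig Fu hu Eu cu (ltnW T4) xy exy.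
    exists v, w; rewrite /multitwig !neighborsE; split=> //; split=> //.
    by rewrite neighbor_joined.
apply/conjugacy_invariantP => r ru.
apply: (twig_product_conj Fu hu cu _ _ ru (perm_refl u))
  => [x y z xy xz y2 z2|x y xy exy].
  by have /card_le1_eqP/(_ z y) := ns x; apply; rewrite inE nonsimple_joined ?xy ?xz.
have [||v [w [vw [jvw c1] c2]]] := tw x y; rewrite ?neighbor_joined ?mult_joined //.
by exists v, w; rewrite -!neighborsE -neighbor_joined.
Qed.
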